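(* Let $K\geq 2$ be an integer, let $N=2K$, and take the ordered sample $(x_1,\ldots,x_{2K})=(1,1.2,\,2,2.2,\,\ldots,K,K+0.2)$, i.e. $x_{2j-1}=j$ and $x_{2j}=j+0.2$ for $j=1,\ldots,K$. Then, for each $k\in\{1,\ldots,K\}$, the log-likelihood function $\ell(\alpha,\mu_1,\mu_2,\sigma_1,\sigma_2)=\sum_{i=1}^N\log f_{\alpha,\mu,\sigma}(x_i)$ of the mixture of two univariate Gaussians has a non-trivial critical point $(\hat\alpha,\hat\mu_1,\hat\mu_2,\hat\sigma_1,\hat\sigma_2)$ with $k<\hat\mu_1<k+0.2$. Hence, $\ell$ has at least $K$ non-trivial critical points.
   Context: The mixture of two univariate Gaussians is the family of probability densities on $\mathbb{R}$ $$f_{\alpha,\mu,\sigma}(x)=\frac{1}{\sqrt{2\pi}}\left[\frac{\alpha}{\sigma_1}\exp\left(-\frac{(x-\mu_1)^2}{2\sigma_1^2}\right)+\frac{1-\alpha}{\sigma_2}\exp\left(-\frac{(x-\mu_2)^2}{2\sigma_2^2}\right)\right],$$ with parameters $(\alpha,\mu_1,\mu_2,\sigma_1,\sigma_2)\in\Theta=[0,1]\times\mathbb{R}^2\times\mathbb{R}_{>0}^2$. The data $x_1,\ldots,x_N$ are fixed constants, and $\ell$ is a function on $\Theta$. A critical point of $\ell$ is a point at which all five partial derivatives of $\ell$ vanish. A critical point $(\hat\alpha,\hat\mu_1,\hat\mu_2,\hat\sigma_1,\hat\sigma_2)$ is non-trivial if it yields a distribution that is not Gaussian, equivalently if $0<\hat\alpha<1$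 and $(\hat\mu_1,\hat\sigma_1)\neq(\hat\mu_2,\hat\sigma_2)$. *)

(* Defs.v *)
From mathcomp Require Import all_boot all_order all_algebra.
From mathcomp Require Import all_classical all_reals all_analysis.

Set Implicit Arguments.
Unset Strict Implicit.
Unset Printing Implicit Defensive.

Import Order.TTheory GRing.Theory Num.Theory.
Import numFieldNormedType.Exports.

Local Open Scope classical_set_scope.
Local Open Scope ring_scope.

(* Parameter vectors are written (a, m1, m2, s1, s2), with s1 and s2 the
   standard deviations (not the variances). *)
Definition param (R : realType) : Type := (R * R * R * R * R)%type.

Definition Theta (R : realType) : set (param R) :=
  [set p | let: (a, m1, m2, s1, s2) := p in [/\ 0 <= a <= 1, 0 < s1 & 0 < s2]].

Definition mixture (R : realType) (p : param R) (x : R) : R :=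
  let: (a, m1, m2, s1, s2) := p in
  (Num.sqrt (2 * pi))^-1 *
    (a / s1 * expR (- ((x - m1) ^+ 2 / (2 * s1 ^+ 2))) +
     (1 - a) / s2 * expR (- ((x - m2) ^+ 2 / (2 * s2 ^+ 2)))).

(* The sample is x 1, ..., x N; the other values of x are irrelevant. *)
Definition loglik (R : realType) (N : nat) (x : nat -> R) (p : param R) : R :=
  \sum_(1 <= i < N.+1) ln (mixture p (x i)).

(* [is_derive a 1 f 0] asserts that f is differentiable at a, with f'(a) = 0.
   At the faces a = 0 and a = 1 of Theta the derivative is two-sided. This is
   harmless for loglik, whose defining formula is smooth on a neighbourhood
   of Theta. *)
Definition critical_point (R : realType) (l : param R -> R) (p : param R) :=
  let: (a, m1, m2, s1, s2) := p in
  Theta p /\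
  [/\ is_derive a 1 (fun t : R => l (t, m1, m2, s1, s2)) 0,
      is_derive m1 1 (fun t : R => l (a, t, m2, s1, s2)) 0,
      is_derive m2 1 (fun t : R => l (a, m1, t, s1, s2)) 0,
      is_derive s1 1 (fun t : R => l (a, m1, m2, t, s2)) 0 &
      is_derive s2 1 (fun t : R => l (a, m1, m2, s1, t)) 0].

(* The hypothesis 0 < s excludes the junk value of normal_pdf at s = 0.
   For a continuous density, being Gaussian as a distribution and being
   everywhere equal to a normal density are the same. *)
Definition gaussian_density (R : realType) (f : R -> R) :=
  exists m s : R, 0 < s /\ f =1 normal_pdf m s.

Definition nontrivial_critical_point (R : realType) (l : param R -> R)
    (p : param R) :=
  critical_point l p /\ ~ gaussian_density (mixture p).

(* Main.v *)
(* Maximise the log-likelihood over a compact box of parameters in which the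
   first component is narrow (9/100 <= s1 <= 21/200) with mean in [k, k + 1/5].
   For K = 2 the second component is confined in the same way to the other pair;
   for K >= 3 it is broad, with m2 in [1, K + 1/5] and
   (K - 1) (K - 2) / 13 <= s2^2 <= K^2, and 2K times the weight of the first one
   is in [1/100, 5/2]. On each face of the box the first-order condition at a
   maximum is violated, so the maximum is interior, hence critical. Each partial
   derivative is a positive multiple of the sum of r_i - alpha, r_i (x_i - m) or
   r_i ((x_i - m)^2 - s^2), with r_i the responsibilities, and the responsibility of the narrow
   component for points outside its pair is negligible. The delicate faces are
   the smallest weight, where the broad component is too thin near the pair to
   explain it, and s1 = 9/100, where the narrow component would have to collapse
   onto a single data point. *)
Require Import Defs.
From mathcomp Require Import all_boot all_order all_algebra.
From mathcomp Require Import all_classical all_reals all_analysis.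
From mathcomp Require Import ring lra.
Import Order.TTheory GRing.Theory Num.Theory.
Import numFieldNormedType.Exports.
Set Implicit Arguments.
Unset Strict Implicit.
Unset Printing Implicit Defensive.
Local Open Scope classical_set_scope.
Local Open Scope card_scope.
Local Open Scope ring_scope.

(** * First-order conditions for a maximum on a box *)

(** The likelihood is unbounded, since a component can collapse onto one data point, so no global
    maximiser exists and a local one has to be fenced in. The faces depend on each other: the small
    weight and the narrow component can only be treated once the broad density near the pair is
    bounded, and that bound must not presuppose an interior maximum. It rests on two halves of
    first-order conditions only, total responsibility at most [A] and a nonpositive second moment of
    the broad component, both available once the upper faces of the weight and of [s2] are excluded.
    Weights and densities are scaled by 2K so that all estimates near the pair are uniform in K.
    Points spread evenly over a length K have variance about K^2/12, so the scaled broad density is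
    about 2 sqrt 12 = 6.93 at its peak; 73/10 is an upper bound that works from K = 3 on. For a pair
    at distance 2/10 the natural standard deviation is 1/10, which 9/100 and 21/200 bracket. For K =
    2, removing a pair leaves a single one, and the lower bound (K - 1)(K - 2)/13 degenerates to 0;
    hence the separate case with two narrow components. *)

Lemma derive_le0_right_max (R : realType) (f : R -> R) (c b d : R) :
  is_derive c 1 f d -> c < b -> (forall t, c <= t <= b -> f t <= f c) ->
  d <= 0.
Proof.
move=> [df <-] cb cmax.
(* Nothing is known to the left of [c], so the derivative is read as the right-hand limit of the
   difference quotient. *)
rewrite ['D_1 f c]cvg_at_rightE; last exact: df.
apply: limr_le.
  rewrite -(cvg_at_rightE (fun h : R => h^-1 *: ((f \o shift c) _ - f c))) //.
  apply: cvg_trans df; apply: cvg_app.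
  move=> A [e egt0 Ae]; exists e => // x xe xgt0; apply: Ae => //.
  exact/lt0r_neq0.
near=> h; apply: mulr_ge0_le0.
  by rewrite invr_ge0; apply: ltW; near: h; exists 1 => /=.
rewrite subr_le0 [_%:A]mulr1; apply: cmax; near: h.
exists (b - c); first by rewrite /= subr_gt0.
move=> h; rewrite /= distrC subr0 => /(le_lt_trans (ler_norm _)) hb h0.
by rewrite lerDr (ltW h0) -lerBrDr ltW.
Unshelve. all: by end_near. Qed.

Lemma derive_ge0_left_max (R : realType) (f : R -> R) (c a d : R) :
  is_derive c 1 f d -> a < c -> (forall t, a <= t <= c -> f t <= f c) ->
  0 <= d.
Proof.
move=> df ac cmax; rewrite -oppr_le0.
have dN : is_derive (- c) 1 (fun t : R => - t) (-1) by apply: is_derive_eq.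
have dg : is_derive (- c) 1 (f \o (fun t : R => - t)) (- d).
  by rewrite -[- d]mulrN1; apply: is_derive1_comp; rewrite opprK.
apply: (derive_le0_right_max dg (b := - a)); first by rewrite ltrN2.
move=> t /andP[ct ta]; rewrite /= opprK; apply: cmax.
by rewrite lerNr ta lerNl ct.
Qed.

Lemma is_derive_bigsum (R : realType) (I : Type) (r : seq I) (h : I -> R -> R)
    (dh : I -> R) (c : R) :
  (forall i, is_derive c 1 (h i) (dh i)) ->
  is_derive c 1 (fun t => \sum_(i <- r) h i t) (\sum_(i <- r) dh i).
Proof.
move=> dhi; elim: r => [|i r IH].
  rewrite big_nil; under eq_fun do rewrite big_nil.
  exact: is_derive_cst.
rewrite big_cons; under eq_fun do rewrite big_cons.
exact: is_deriveD.
Qed.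

(** The normal density without its factor 1 / sqrt (2 pi), which cancels in every responsibility. *)
Definition gden (R : realType) (s m y : R) : R :=
  s^-1 * expR (- ((y - m) ^+ 2 / (2 * s ^+ 2))).

Definition gmix (R : realType) (a m1 m2 s1 s2 y : R) : R :=
  a * gden s1 m1 y + (1 - a) * gden s2 m2 y.

Definition resp (R : realType) (a m1 m2 s1 s2 y : R) : R :=
  a * gden s1 m1 y / gmix a m1 m2 s1 s2 y.

Section Calculus.
Context {R : realType}.
Implicit Types a m s y : R.

Lemma gden_gt0 s m y : 0 < s -> 0 < gden s m y.
Proof. by move=> s0; rewrite mulr_gt0 ?expR_gt0// invr_gt0. Qed.

Lemma is_derive_gden_mean s m y : 0 < s ->
  is_derive m 1 (fun t => gden s t y) (gden s m y * ((y - m) / s ^+ 2)).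
Proof.
move=> s0.
have d1 : is_derive m 1 (fun t : R => - ((y - t) ^+ 2 / (2 * s ^+ 2)))
    ((y - m) / s ^+ 2).
  apply: is_derive_eq; rewrite /GRing.scale/=; field; exact: lt0r_neq0.
have dE := is_deriveZ s^-1 (is_derive1_comp (is_derive_expR _) d1).
by apply: is_derive_eq dE _; rewrite /GRing.scale/= /gden/=; ring.
Qed.

Lemma is_derive_gden_sd s m y : 0 < s ->
  is_derive s 1 (fun t => gden t m y)
    (gden s m y * (((y - m) ^+ 2 - s ^+ 2) / s ^+ 3)).
Proof.
move=> s0; have s1 := lt0r_neq0 s0.
have dV : is_derive s 1 (fun t : R => t^-1) (- s ^- 2).
  by have := is_deriveV s1 (is_derive_id s (1:R)); rewrite [_ *: _]mulr1.
have d1 : is_derive s 1 (fun t : R => - ((y - m) ^+ 2 / (2 * t ^+ 2)))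
    ((y - m) ^+ 2 / s ^+ 3).
  (* As a polynomial in the inverse of [t], the function is within reach of instance resolution
     through [dV]. *)
  rewrite (_ : (fun t : R => - ((y - m) ^+ 2 / (2 * t ^+ 2))) =
    (fun t => (- (y - m) ^+ 2 / 2) * t^-1 ^+ 2)).
    by apply: is_derive_eq; rewrite /GRing.scale/=; field.
  by apply/funext => t; rewrite invfM exprVn; ring.
have dE := is_deriveM dV (is_derive1_comp (is_derive_expR _) d1).
by apply: is_derive_eq dE _; rewrite /GRing.scale/= /gden/=; field.
Qed.

End Calculus.

(** * Partial derivatives of the log-likelihood in terms of responsibilities *)

Section Loglik.
Context {R : realType}.
Implicit Types a m s y : R.

Lemma mixtureE a m1 m2 s1 s2 y :
  mixture (a, m1, m2, s1, s2) y =
  (Num.sqrt (2 * pi))^-1 * gmix a m1 m2 s1 s2 y.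
Proof. by rewrite /mixture /gmix /gden !mulrA. Qed.

Lemma gmix_gt0 a m1 m2 s1 s2 y : 0 < a < 1 -> 0 < s1 -> 0 < s2 ->
  0 < gmix a m1 m2 s1 s2 y.
Proof.
by move=> /andP[a0 a1] p1 p2; rewrite addr_gt0// mulr_gt0 ?gden_gt0 ?subr_gt0.
Qed.

Lemma gmix_swap a m1 m2 s1 s2 y :
  gmix (1 - a) m2 m1 s2 s1 y = gmix a m1 m2 s1 s2 y.
Proof. by rewrite /gmix subKr addrC. Qed.

Lemma resp_swap a m1 m2 s1 s2 y : 0 < a < 1 -> 0 < s1 -> 0 < s2 ->
  resp (1 - a) m2 m1 s2 s1 y = 1 - resp a m1 m2 s1 s2 y.
Proof.
move=> a01 p1 p2; have := lt0r_neq0 (gmix_gt0 m1 m2 y a01 p1 p2).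
by rewrite /resp gmix_swap {1 2}/gmix => ne; rewrite /gmix; field.
Qed.

(** Relabelling symmetry: derivatives in the second mean and standard deviation follow from those in
    the first. *)
Lemma loglik_swap N (x : nat -> R) a m1 m2 s1 s2 :
  loglik N x (1 - a, m2, m1, s2, s1) = loglik N x (a, m1, m2, s1, s2).
Proof. by apply: eq_bigr => i _; rewrite !mixtureE gmix_swap. Qed.

Lemma sqrt2pi_gt0 : 0 < (Num.sqrt (2 * pi))^-1 :> R.
Proof. by rewrite invr_gt0 sqrtr_gt0 mulr_gt0 ?pi_gt0. Qed.

Lemma is_derive_sum_ln N (C c : R) (q : nat -> R -> R) (dq : nat -> R) :
  0 < C -> (forall i, 0 < q i c) -> (forall i, is_derive c 1 (q i) (dq i)) ->
  is_derive c 1 (fun t => \sum_(1 <= i < N.+1) ln (C * q i t))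
    (\sum_(1 <= i < N.+1) dq i / q i c).
Proof.
move=> C0 q0 dqi; apply: is_derive_bigsum => i.
have d1 := is_deriveZ C (dqi i).
have d2 := is_derive1_comp (g := fun t => C * q i t)
  (is_derive1_ln (mulr_gt0 C0 (q0 i))) d1.
apply: is_derive_eq d2 _.
have := lt0r_neq0 (q0 i); have := lt0r_neq0 C0.
by rewrite /GRing.scale/= => ? ?; field; apply/andP.
Qed.

Variables (N : nat) (x : nat -> R) (a m1 m2 s1 s2 : R).
Hypotheses (a01 : 0 < a < 1) (s1_gt0 : 0 < s1) (s2_gt0 : 0 < s2).
Let r := resp a m1 m2 s1 s2.
Let mix_gt0 i : 0 < gmix a m1 m2 s1 s2 (x i).
Proof. exact: gmix_gt0. Qed.

Lemma is_derive_loglik_weight :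
  is_derive a 1 (fun t => loglik N x (t, m1, m2, s1, s2))
    ((a * (1 - a))^-1 * \sum_(1 <= i < N.+1) (r (x i) - a)).
Proof.
have [a0 a1] := andP a01.
rewrite /loglik; under eq_fun do under eq_bigr do rewrite mixtureE.
have dq i : is_derive a 1 (fun t => gmix t m1 m2 s1 s2 (x i))
    (gden s1 m1 (x i) - gden s2 m2 (x i)).
  by rewrite /gmix; apply: is_derive_eq; rewrite /GRing.scale/=; ring.
apply: is_derive_eq (is_derive_sum_ln N sqrt2pi_gt0 mix_gt0 dq) _.
rewrite big_distrr/=; apply: eq_bigr => i _.
have := lt0r_neq0 (mix_gt0 i).
rewrite /r /resp /gmix /GRing.scale/= => ne; field.
by rewrite ne !gt_eqF//= subr_gt0.
Qed.

Lemma is_derive_loglik_mean :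
  is_derive m1 1 (fun t => loglik N x (a, t, m2, s1, s2))
    ((s1 ^+ 2)^-1 * \sum_(1 <= i < N.+1) (r (x i) * (x i - m1))).
Proof.
rewrite /loglik; under eq_fun do under eq_bigr do rewrite mixtureE.
have dq i := is_deriveD (is_deriveZ a (is_derive_gden_mean m1 (x i) s1_gt0))
    (is_derive_cst ((1 - a) * gden s2 m2 (x i)) m1 (1 : R)).
apply: is_derive_eq (is_derive_sum_ln (q := fun i t => gmix a t m2 s1 s2 (x i))
  N sqrt2pi_gt0 mix_gt0 dq) _.
rewrite big_distrr/=; apply: eq_bigr => i _.
have := lt0r_neq0 (mix_gt0 i).
by rewrite /r /resp /gmix /GRing.scale/= => ne; field; rewrite ne gt_eqF.
Qed.

Lemma is_derive_loglik_sd :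
  is_derive s1 1 (fun t => loglik N x (a, m1, m2, t, s2))
    ((s1 ^+ 3)^-1 *
     \sum_(1 <= i < N.+1) (r (x i) * ((x i - m1) ^+ 2 - s1 ^+ 2))).
Proof.
rewrite /loglik; under eq_fun do under eq_bigr do rewrite mixtureE.
have dq i := is_deriveD (is_deriveZ a (is_derive_gden_sd m1 (x i) s1_gt0))
    (is_derive_cst ((1 - a) * gden s2 m2 (x i)) s1 (1 : R)).
apply: is_derive_eq (is_derive_sum_ln (q := fun i t => gmix a m1 m2 t s2 (x i))
  N sqrt2pi_gt0 mix_gt0 dq) _.
rewrite big_distrr/=; apply: eq_bigr => i _.
have := lt0r_neq0 (mix_gt0 i).
by rewrite /r /resp /gmix /GRing.scale/= => ne; field; rewrite ne gt_eqF.
Qed.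

End Loglik.

(** * Maximisers over a box and their face conditions *)

Section BoxMaximum.
Context {R : realType}.
Implicit Types a m s y t d lo hi : R.

Definition in_box (p l h : param R) :=
  let: (a, m1, m2, s1, s2) := p in
  let: (la, lm1, lm2, ls1, ls2) := l in
  let: (ha, hm1, hm2, hs1, hs2) := h in
  [/\ la <= a <= ha, lm1 <= m1 <= hm1, lm2 <= m2 <= hm2,
      ls1 <= s1 <= hs1 & ls2 <= s2 <= hs2].

(* The first-order condition at a maximiser over [lo, hi], when the derivative
   is a positive multiple of d. *)
Definition face_cond lo hi t d := (lo < t -> 0 <= d) /\ (t < hi -> d <= 0).

Lemma face_cond_interior lo hi t d :
  face_cond lo hi t d -> lo < t -> t < hi -> d = 0.
Proof. by move=> [A B] /A d0 /B d1; apply/eqP; rewrite eq_le d0 d1. Qed.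

Lemma face_cond_max (f : R -> R) lo hi t c d :
  0 < c -> is_derive t 1 f (c * d) -> lo <= t <= hi ->
  (forall u, lo <= u <= hi -> f u <= f t) -> face_cond lo hi t d.
Proof.
move=> c0 df /andP[lot thi] fmax; split=> lt.
  rewrite -(pmulr_rge0 _ c0); apply: (derive_ge0_left_max df lt) => u.
  by move=> /andP[? ut]; apply: fmax; apply/andP; split => //; exact: le_trans thi.
rewrite -(pmulr_rle0 _ c0); apply: (derive_le0_right_max df lt) => u.
by move=> /andP[tu ?]; apply: fmax; apply/andP; split => //; exact: le_trans tu.
Qed.

Lemma continuous_loglik N (x : nat -> R) a m1 m2 s1 s2 :
  0 < a < 1 -> 0 < s1 -> 0 < s2 ->
  {for ((a, m1, m2, s1, s2) : param R), continuous (loglik N x)}.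
Proof.
move=> a01 p1 p2; set p := (a, m1, m2, s1, s2).
have -> : loglik N x = fun q : param R => \sum_(1 <= i < N.+1)
    ln ((Num.sqrt (2 * pi))^-1 *
        gmix q.1.1.1.1 q.1.1.1.2 q.1.1.2 q.1.2 q.2 (x i)).
  by apply/funext => -[[[[b n1] n2] t1] t2]; apply: eq_bigr => i _; rewrite mixtureE.
have c1 : {for p, continuous (fun q : param R => q.1)} by exact: cvg_fst.
have c2 : {for p, continuous (fun q : param R => q.2)} by exact: cvg_snd.
have c11 : {for p, continuous (fun q : param R => q.1.1)}.
  by apply: continuous_comp; [exact: c1|exact: cvg_fst].
have c12 : {for p, continuous (fun q : param R => q.1.2)}.
  by apply: continuous_comp; [exact: c1|exact: cvg_snd].
have c111 : {for p, continuous (fun q : param R => q.1.1.1)}.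
  by apply: continuous_comp; [exact: c11|exact: cvg_fst].
have c112 : {for p, continuous (fun q : param R => q.1.1.2)}.
  by apply: continuous_comp; [exact: c11|exact: cvg_snd].
have c1111 : {for p, continuous (fun q : param R => q.1.1.1.1)}.
  by apply: continuous_comp; [exact: c111|exact: cvg_fst].
have c1112 : {for p, continuous (fun q : param R => q.1.1.1.2)}.
  by apply: continuous_comp; [exact: c111|exact: cvg_snd].
have cg (f g : param R -> R) y : {for p, continuous f} ->
    {for p, continuous g} -> 0 < f p ->
    {for p, continuous (fun q : param R => gden (f q) (g q) y)}.
  move=> cf cgg fp.
  have nf : f p != 0 by rewrite gt_eqF.
  have n2f : 2 * f p ^+ 2 != 0 by rewrite mulf_neq0 ?expf_neq0 ?pnatr_eq0.
  have cst (r : R) : {for p, continuous (fun=> r : R)} by exact: cst_continuous.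
  apply: continuousM; first exact: continuousV.
  apply: (continuous_comp (f := fun q => - ((y - g q) ^+ 2 / (2 * f q ^+ 2)))
    (g := expR));
    last exact: continuous_expR.
  apply: continuousN; apply: continuousM.
    apply: (continuous_comp (f := fun q => y - g q)
      (g := fun z : R => z ^+ 2)); last exact: exprn_continuous.
    exact: continuousB.
  apply: continuousV => //; apply: continuousM => //.
  by apply: (continuous_comp (f := f) (g := fun z : R => z ^+ 2));
    [exact: cf|exact: exprn_continuous].
apply: cvg_big => [|i _]; first exact: add_continuous.
apply: (continuous_comp (f := fun q : param R => (Num.sqrt (2 * pi))^-1 *
        gmix q.1.1.1.1 q.1.1.1.2 q.1.1.2 q.1.2 q.2 (x i)) (g := @ln R)); last first.
  by apply: continuous_ln; rewrite mulr_gt0 ?sqrt2pi_gt0//; exact: gmix_gt0.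
apply: continuousM; first exact: cst_continuous.
apply: continuousD; apply: continuousM => //.
- exact: cg.
- by apply: continuousB => //; exact: cst_continuous.
- exact: cg.
Qed.

(** With weights inside (0, 1) and standard deviations away from 0, the log-likelihood is continuous
    on a compact box and smooth across its faces, so a maximiser exists and each partial derivative
    has a sign there. *)
Lemma exists_box_max N (x : nat -> R)
    (la ha lm1 hm1 lm2 hm2 ls1 hs1 ls2 hs2 : R) :
  0 < la -> la <= ha -> ha < 1 -> lm1 <= hm1 -> lm2 <= hm2 ->
  0 < ls1 -> ls1 <= hs1 -> 0 < ls2 -> ls2 <= hs2 ->
  exists a m1 m2 s1 s2,
  let r := resp a m1 m2 s1 s2 in
  let S F := \sum_(1 <= i < N.+1) F (x i) in
  in_box (a, m1, m2, s1, s2) (la, lm1, lm2, ls1, ls2) (ha, hm1, hm2, hs1, hs2)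
  /\ [/\ face_cond la ha a (S (fun y => r y - a)),
      face_cond lm1 hm1 m1 (S (fun y => r y * (y - m1))),
      face_cond lm2 hm2 m2 (S (fun y => (1 - r y) * (y - m2))),
      face_cond ls1 hs1 s1 (S (fun y => r y * ((y - m1) ^+ 2 - s1 ^+ 2))) &
      face_cond ls2 hs2 s2 (S (fun y => (1 - r y) * ((y - m2) ^+ 2 - s2 ^+ 2)))].
Proof.
move=> la0 laha ha1 m1lh m2lh s1l0 s1lh s2l0 s2lh.
pose D : set (param R) := `[la, ha] `*` `[lm1, hm1] `*` `[lm2, hm2]
  `*` `[ls1, hs1] `*` `[ls2, hs2].
have DP a m1 m2 s1 s2 : D (a, m1, m2, s1, s2) <-> in_box (a, m1, m2, s1, s2)
    (la, lm1, lm2, ls1, ls2) (ha, hm1, hm2, hs1, hs2).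
  rewrite /D /in_box /= !in_itv/=; split.
    by move=> [[[[]]]].
  by move=> [].
have cD : compact D.
  by rewrite /D; do 4! (apply: compact_setX; last exact: segment_compact);
    exact: segment_compact.
have D0 : D !=set0.
  exists (la, lm1, lm2, ls1, ls2); apply/DP.
  by rewrite /in_box !lexx laha m1lh m2lh s1lh s2lh.
have pos a m1 m2 s1 s2 : in_box (a, m1, m2, s1, s2)
    (la, lm1, lm2, ls1, ls2) (ha, hm1, hm2, hs1, hs2) ->
    [/\ 0 < a < 1, 0 < s1 & 0 < s2].
  move=> [/andP[A1 A2] _ _ /andP[B1 _] /andP[C1 _]]; split.
  - by rewrite (lt_le_trans la0)//= (le_lt_trans A2).
  - exact: lt_le_trans B1.
  - exact: lt_le_trans C1.
have cl : {within D, continuous (loglik N x)}.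
  apply: continuous_in_subspaceT => -[[[[a m1] m2] s1] s2].
  by rewrite inE => /DP/pos[? ? ?]; exact: continuous_loglik.
have [[[[[a m1] m2] s1] s2]] := compact_EVT_max D0 cD cl.
rewrite inE => /DP bx mx.
have {}mx b n1 n2 t1 t2 : in_box (b, n1, n2, t1, t2)
    (la, lm1, lm2, ls1, ls2) (ha, hm1, hm2, hs1, hs2) ->
    loglik N x (b, n1, n2, t1, t2) <= loglik N x (a, m1, m2, s1, s2).
  by move=> /DP ?; apply: mx; rewrite inE.
exists a, m1, m2, s1, s2 => r S; split=> //.
have [a01 s10 s20] := pos _ _ _ _ _ bx.
have b01 : 0 < 1 - a < 1 by move: a01; lra.
have [ba bm1 bm2 bs1 bs2] := bx.
split.
- apply: (face_cond_max _ (is_derive_loglik_weight N x m1 m2 a01 s10 s20)) => //.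
    by rewrite invr_gt0 mulr_gt0//; move: a01; lra.
  by move=> u bu; exact: mx.
- apply: (face_cond_max _ (is_derive_loglik_mean N x m1 m2 a01 s10 s20)) => //.
    by rewrite invr_gt0 exprn_gt0.
  by move=> u bu; exact: mx.
- have := is_derive_loglik_mean N x m2 m1 b01 s20 s10.
  under eq_fun do rewrite loglik_swap.
  under eq_bigr do rewrite resp_swap//.
  move=> d; apply: (face_cond_max _ d) => //.
    by rewrite invr_gt0 exprn_gt0.
  by move=> u bu; exact: mx.
- apply: (face_cond_max _ (is_derive_loglik_sd N x m1 m2 a01 s10 s20)) => //.
    by rewrite invr_gt0 exprn_gt0.
  by move=> u bu; exact: mx.
- have := is_derive_loglik_sd N x m2 m1 b01 s20 s10.
  under eq_fun do rewrite loglik_swap.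
  under eq_bigr do rewrite resp_swap//.
  move=> d; apply: (face_cond_max _ d) => //.
    by rewrite invr_gt0 exprn_gt0.
  by move=> u bu; exact: mx.
Qed.

Lemma critical_point_loglik N (x : nat -> R) a m1 m2 s1 s2 :
  0 < a < 1 -> 0 < s1 -> 0 < s2 ->
  let r := resp a m1 m2 s1 s2 in
  let S F := \sum_(1 <= i < N.+1) F (x i) in
  S (fun y => r y - a) = 0 -> S (fun y => r y * (y - m1)) = 0 ->
  S (fun y => (1 - r y) * (y - m2)) = 0 ->
  S (fun y => r y * ((y - m1) ^+ 2 - s1 ^+ 2)) = 0 ->
  S (fun y => (1 - r y) * ((y - m2) ^+ 2 - s2 ^+ 2)) = 0 ->
  critical_point (loglik N x) (a, m1, m2, s1, s2).
Proof.
move=> a01 p1 p2 r S Sa S1 S2 T1 T2.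
have b01 : 0 < 1 - a < 1 by move: a01; lra.
split.
  by have [/ltW a0 /ltW a1] := andP a01; split => //; apply/andP.
split.
- by apply: is_derive_eq (is_derive_loglik_weight N x m1 m2 a01 p1 p2) _;
    rewrite [X in _ * X]Sa mulr0.
- by apply: is_derive_eq (is_derive_loglik_mean N x m1 m2 a01 p1 p2) _;
    rewrite [X in _ * X]S1 mulr0.
- have := is_derive_loglik_mean N x m2 m1 b01 p2 p1.
  under eq_fun do rewrite loglik_swap.
  under eq_bigr do rewrite resp_swap//.
  by rewrite [X in _ * X]S2 mulr0.
- by apply: is_derive_eq (is_derive_loglik_sd N x m1 m2 a01 p1 p2) _;
    rewrite [X in _ * X]T1 mulr0.
- have := is_derive_loglik_sd N x m2 m1 b01 p2 p1.
  under eq_fun do rewrite loglik_swap.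
  under eq_bigr do rewrite resp_swap//.
  by rewrite [X in _ * X]T2 mulr0.
Qed.

End BoxMaximum.

(** * Mixtures that are not Gaussian *)

Section NonGaussian.
Context {R : realType}.

Lemma quadratic_neg (p q r : R) :
  (forall y, p * y ^+ 2 + q * y + r < 0) -> p < 0 \/ p = 0 /\ q = 0.
Proof.
move=> neg; have [p0|p0|p0] := ltgtP p 0; first by left.
(* A point [y >= 1] with [p * y] large enough to outweigh both lower-order coefficients. *)
- have := neg (1 + (`|q| + `|r|) / p).
  set y := 1 + _; have py : p * y = p + `|q| + `|r| by rewrite /y; field; lra.
  have y1 : 1 <= y by rewrite lerDl divr_ge0 ?addr_ge0// ltW.
  have := ler_norm (- q); have := ler_norm (- r); rewrite !normrN.
  by have := normr_ge0 q; have := normr_ge0 r; nra.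
- right; split=> //; apply/eqP; apply: contraT => q0.
  have := neg (- r / q).
  by rewrite p0 (_ : _ + r = 0) ?ltxx//; field.
Qed.

Lemma quadratic_le_at_large (p q r y : R) : p < 0 ->
  1 + (`|q| + `|r| + 2) / - p <= y -> p * y ^+ 2 + q * y + r <= - 2.
Proof.
move=> p0; rewrite -lerBrDl ler_pdivrMr ?oppr_gt0// => h.
have y1 : 1 <= y by have := normr_ge0 q; have := normr_ge0 r; nra.
have := ler_norm q; have := ler_norm r.
by have := normr_ge0 q; have := normr_ge0 r; nra.
Qed.

(** Each term is below 1, so each exponent is negative everywhere: strictly concave or constant. Two
    strictly concave exponents make both terms at most 1/3 at the far point [1 + u + v]; if one
    exponent is constant, so is the other. *)
Lemma expR_quadratic_sum_eq1 (p q r p' q' r' : R) :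
  (forall y, expR (p * y ^+ 2 + q * y + r) +
             expR (p' * y ^+ 2 + q' * y + r') = 1) ->
  [/\ p = 0, q = 0, p' = 0 & q' = 0].
Proof.
move=> sum1.
have neg1 y : p * y ^+ 2 + q * y + r < 0.
  rewrite -expR_lt1 -(sum1 y) ltrDl; exact: expR_gt0.
have neg2 y : p' * y ^+ 2 + q' * y + r' < 0.
  rewrite -expR_lt1 -(sum1 y) ltrDr; exact: expR_gt0.
have [p0|[p0 q0]] := quadratic_neg neg1;
  have [p0'|[p0' q0']] := quadratic_neg neg2.
- exfalso; pose u := (`|q| + `|r| + 2) / - p; pose v := (`|q'| + `|r'| + 2) / - p'.
  have u0 : 0 <= u by rewrite divr_ge0 ?addr_ge0// ltW// oppr_gt0.
  have v0 : 0 <= v by rewrite divr_ge0 ?addr_ge0// ltW// oppr_gt0.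
  have e13 : expR (- 2) <= 3^-1 :> R.
    rewrite expRN lef_pV2 ?posrE ?expR_gt0//.
    by apply: le_trans (expR_ge1Dx _); lra.
  have E1 : expR (p * (1 + u + v) ^+ 2 + q * (1 + u + v) + r) <= 3^-1.
    apply: le_trans e13; rewrite ler_expR; apply: quadratic_le_at_large => //.
    by rewrite -/u; lra.
  have E2 : expR (p' * (1 + u + v) ^+ 2 + q' * (1 + u + v) + r') <= 3^-1.
    apply: le_trans e13; rewrite ler_expR; apply: quadratic_le_at_large => //.
    by rewrite -/v; lra.
  by have := sum1 (1 + u + v); lra.
- have c y : p * y ^+ 2 + q * y + r = r.
    have := sum1 y; have := sum1 0; rewrite p0' q0' => <-.
    move=> /eqP; rewrite !mul0r !add0r (inj_eq (addIr _)) => /eqP /expR_inj ->.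
    by rewrite expr0n mulr0 mulr0 !add0r.
  by have := c 1; have := c (- 1); split=> //; lra.
- have c y : p' * y ^+ 2 + q' * y + r' = r'.
    have := sum1 y; have := sum1 0; rewrite p0 q0 => <-.
    move=> /eqP; rewrite !mul0r !add0r (inj_eq (addrI _)) => /eqP /expR_inj ->.
    by rewrite expr0n mulr0 mulr0 !add0r.
  by have := c 1; have := c (- 1); split=> //; lra.
- by [].
Qed.

(** Dividing by the supposed normal density leaves two exponentials of quadratics with sum 1. Both
    quadratics are then constant, and comparing coefficients identifies both components with that
    normal law. *)
Lemma mixture_not_gaussian (a m1 m2 s1 s2 : R) :
  0 < a < 1 -> 0 < s1 -> 0 < s2 -> (m1, s1) <> (m2, s2) ->
  ~ gaussian_density (mixture (a, m1, m2, s1, s2)).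
Proof.
move=> /andP[a0 a1] p1 p2 ne [m [s [s0 eqf]]]; apply: ne.
pose C : R := Num.sqrt (2 * pi) * normal_peak s.
have C0 : 0 < C.
  rewrite mulr_gt0 ?sqrtr_gt0 ?mulr_gt0 ?pi_gt0//.
  by apply: normal_peak_gt0; rewrite gt_eqF.
pose c1 : R := a / s1 / C; pose c2 : R := (1 - a) / s2 / C.
have c10 : 0 < c1 by do 2 apply: divr_gt0 => //.
have c20 : 0 < c2 by do 2 apply: divr_gt0 => //; rewrite subr_gt0.
have n1 : s1 != 0 by rewrite gt_eqF.
have n2 : s2 != 0 by rewrite gt_eqF.
have n : s != 0 by rewrite gt_eqF.
have sum1 y :
  c1 * expR ((y - m) ^+ 2 / (2 * s ^+ 2) - (y - m1) ^+ 2 / (2 * s1 ^+ 2)) +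
  c2 * expR ((y - m) ^+ 2 / (2 * s ^+ 2) - (y - m2) ^+ 2 / (2 * s2 ^+ 2)) = 1.
  have := eqf y; rewrite mixtureE /normal_pdf (negbTE n) /normal_fun => e.
  have sq0 : Num.sqrt (2 * pi) != 0 :> R.
    by rewrite gt_eqF// sqrtr_gt0 mulr_gt0 ?pi_gt0.
  pose E0 : R := expR ((y - m) ^+ 2 / (2 * s ^+ 2)).
  pose E1 : R := expR (- ((y - m1) ^+ 2 / (2 * s1 ^+ 2))).
  pose E2 : R := expR (- ((y - m2) ^+ 2 / (2 * s2 ^+ 2))).
  have E00 : E0 != 0 by rewrite gt_eqF// expR_gt0.
  have e' : a * (s1^-1 * E1) + (1 - a) * (s2^-1 * E2) = C / E0.
    apply: (mulfI (invr_neq0 sq0)).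
    rewrite [LHS]e/= /E0 -expRN /C !mulrA mulVf// mul1r.
    by rewrite mulNr -mulrA (mulr_natl (s ^+ 2) 2).
  rewrite !expRD -/E0 -/E1 -/E2 /c1 /c2.
  transitivity ((a * (s1^-1 * E1) + (1 - a) * (s2^-1 * E2)) / C * E0); last first.
    by rewrite e'; field; rewrite E00 gt_eqF.
  by field; rewrite n1 n2 gt_eqF.
have [] := @expR_quadratic_sum_eq1 ((2 * s ^+ 2)^-1 - (2 * s1 ^+ 2)^-1)
  (m1 / s1 ^+ 2 - m / s ^+ 2)
  (m ^+ 2 / (2 * s ^+ 2) - m1 ^+ 2 / (2 * s1 ^+ 2) + ln c1)
  ((2 * s ^+ 2)^-1 - (2 * s2 ^+ 2)^-1)
  (m2 / s2 ^+ 2 - m / s ^+ 2)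
  (m ^+ 2 / (2 * s ^+ 2) - m2 ^+ 2 / (2 * s2 ^+ 2) + ln c2).
  move=> y; rewrite -[RHS](sum1 y).
  have K (c u : R) : 0 < c -> c * expR u = expR (ln c + u).
    by move=> c0; rewrite expRD lnK.
  by rewrite !K//; congr (_ + _); congr expR; field; rewrite ?n ?n1 ?n2.
move=> P1 Q1 P2 Q2.
have E (t : R) : t != 0 -> 0 < t -> (2 * s ^+ 2)^-1 - (2 * t ^+ 2)^-1 = 0 -> s = t.
  move=> t0 tp /eqP; rewrite subr_eq0 => /eqP /invr_inj /(mulfI _) h.
  have /eqP : s ^+ 2 = t ^+ 2 by apply: h; rewrite pnatr_eq0.
  by rewrite eqrXn2 ?ltW// => /eqP.
have e1 := E _ n1 p1 P1; have e2 := E _ n2 p2 P2; subst s2; subst s1.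
congr (_, _); have /mulIf : (s ^+ 2)^-1 != 0 by rewrite invr_eq0 expf_neq0.
by apply; lra.
Qed.

End NonGaussian.

(** * Sums over the sample *)

Section PairSums.
Context {R : realType}.
Implicit Types (K k j : nat) (F G : R -> R) (y : R).

Definition pair_sum K F : R :=
  \sum_(1 <= j < K.+1) (F j%:R + F (j%:R + 2 / 10)).

Definition off_sum K k F : R :=
  \sum_(1 <= j < K.+1 | j != k) (F j%:R + F (j%:R + 2 / 10)).

Definition off_point K k y := exists j,
  [/\ (1 <= j <= K)%N, j != k & y = j%:R \/ y = j%:R + 2 / 10].

Lemma sample_sum K (x : nat -> R) F :
  (forall j, (1 <= j <= K)%N ->
    x (2 * j - 1)%N = j%:R /\ x (2 * j)%N = j%:R + 2 / 10) ->
  \sum_(1 <= i < (2 * K).+1) F (x i) = pair_sum K F.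
Proof.
elim: K => [|K IH] hx; first by rewrite /pair_sum !big_geq.
rewrite [RHS]big_nat_recr//= -/(pair_sum K F) -IH; last first.
  by move=> j /andP[j1 jK]; apply: hx; rewrite j1 (leq_trans jK).
have [e1 e2] := hx K.+1 (leqnn _).
rewrite (_ : (2 * K.+1).+1 = (2 * K).+3); last by rewrite mulnS.
rewrite big_nat_recr//= big_nat_recr//= -addrA -e2 -e1.
by congr (_ + (F (x _) + F (x _))); rewrite mulnS// add2n subn1.
Qed.

Lemma pair_sumD1 K k F : (1 <= k <= K)%N ->
  pair_sum K F = F k%:R + F (k%:R + 2 / 10) + off_sum K k F.
Proof.
move=> hk; rewrite /pair_sum (bigD1_seq k) ?iota_uniq// mem_index_iota.
by rewrite ltnS.
Qed.

Lemma pair_sumD K F G :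
  pair_sum K (fun y => F y + G y) = pair_sum K F + pair_sum K G.
Proof. by rewrite -big_split; apply: eq_bigr => j _; rewrite addrACA. Qed.

Lemma pair_sumZ K (c : R) F :
  pair_sum K (fun y => c * F y) = c * pair_sum K F.
Proof. by rewrite big_distrr; apply: eq_bigr => j _; rewrite /= mulrDr. Qed.

Lemma pair_sum_cst K (c : R) : pair_sum K (fun=> c) = (2 * K%:R) * c.
Proof.
rewrite /pair_sum big_const_nat subSS subn0 iter_addr_0 -mulr_natl; ring.
Qed.

Lemma off_sumZ K k (c : R) F :
  off_sum K k (fun y => c * F y) = c * off_sum K k F.
Proof. by rewrite big_distrr; apply: eq_bigr => j _; rewrite /= mulrDr. Qed.

Lemma off_sumD K k F G :
  off_sum K k (fun y => F y + G y) = off_sum K k F + off_sum K k G.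
Proof. by rewrite -big_split; apply: eq_bigr => j _; rewrite addrACA. Qed.

Lemma off_sum_le K k F G : (forall y, off_point K k y -> F y <= G y) ->
  off_sum K k F <= off_sum K k G.
Proof.
move=> FG; rewrite /off_sum big_nat_cond [leRHS]big_nat_cond.
apply: ler_sum => j /andP[jK jk].
by apply: lerD; apply: FG; exists j; split; auto.
Qed.

Lemma pair_sum_ext K F G : F =1 G -> pair_sum K F = pair_sum K G.
Proof. by move=> FG; apply: eq_bigr => j _; rewrite !FG. Qed.

Lemma off_sum_ge0 K k F : (forall y, off_point K k y -> 0 <= F y) ->
  0 <= off_sum K k F.
Proof.
move=> F0; rewrite -(mul0r (off_sum K k F)) -off_sumZ.
by apply: off_sum_le => y /F0; rewrite mul0r.
Qed.

Lemma sum_geometric_distance (q : R) K k : 0 <= q -> q < 1 ->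
  \sum_(1 <= j < K.+1 | j != k) q ^+ (maxn j k - minn j k) <= 2 * q / (1 - q).
Proof.
move=> q0 q1; have d0 : 0 < 1 - q by rewrite subr_gt0.
(* The bound is that of the full geometric series continued to the left of index 1, which makes the
   induction step an identity. *)
have low n : (n < k)%N ->
    \sum_(1 <= j < n.+1 | j != k) q ^+ (maxn j k - minn j k)
    <= q ^+ (k - n) / (1 - q).
  elim: n => [|n IH] nk.
    by rewrite big_geq// divr_ge0 ?exprn_ge0// ltW.
  rewrite big_mkcond big_nat_recr//= -big_mkcond/= (ltn_eqF nk)/=.
  rewrite (maxn_idPr (ltnW nk)) (minn_idPl (ltnW nk)).
  have h := IH (ltnW nk).
  have -> : q ^+ (k - n.+1) / (1 - q) = q ^+ (k - n) / (1 - q) + q ^+ (k - n.+1).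
    by rewrite -(subnSK (ltnW nk)) exprS; move: (q ^+ _) => z; field; rewrite gt_eqF.
  by rewrite lerD2r.
have [Kk|kK] := ltnP K k.
  apply: le_trans (low _ Kk) _; rewrite ler_pM2r ?invr_gt0//.
  have : q ^+ (k - K) <= q ^+ 1.
    by apply: ler_wiXn2l => //; [exact: ltW|rewrite subn_gt0].
  by rewrite expr1; lra.
(* The full left series contributes [q / (1 - q)] and the finite right part
   [(q - q ^+ n.+1) / (1 - q)]. *)
suff H n : \sum_(1 <= j < (k + n).+1 | j != k) q ^+ (maxn j k - minn j k)
    <= (2 * q - q ^+ n.+1) / (1 - q).
  have := H (K - k)%N; rewrite subnKC// => /le_trans; apply.
  rewrite ler_pM2r ?invr_gt0// lerBlDr lerDl exprn_ge0//.
elim: n => [|n IH].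
  rewrite addn0 expr1 (_ : 2 * q - q = q); last by ring.
  case: k kK low => [|k] kK low.
    by rewrite big_geq// divr_ge0// ltW.
  rewrite big_mkcond big_nat_recr//= -big_mkcond/= eqxx/= addr0.
  by have := low k (ltnSn k); rewrite subSnn expr1.
rewrite addnS big_mkcond big_nat_recr//=.
have kn : (k <= (k + n).+1)%N by rewrite leqW// leq_addr.
rewrite -big_mkcond/= gtn_eqF/= ?ltnS ?leq_addr//.
rewrite (maxn_idPl kn) (minn_idPr kn) -addnS addKn.
have -> : (2 * q - q ^+ n.+2) / (1 - q) =
    (2 * q - q ^+ n.+1) / (1 - q) + q ^+ n.+1.
  by rewrite (exprS _ n.+1); move: (q ^+ _) => z; field; rewrite gt_eqF.
by rewrite lerD2r addnS.
Qed.

End PairSums.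

(** * Responsibility of a narrow component outside its pair *)

Section Leakage.
Context {R : realType}.
Implicit Types (K k j : nat) (y : R).

(** Source of the rational lower bounds for exponentials; the exponents 16, 32 and 64 used later are
    chosen for the precision needed. *)
Lemma expR_ge_pow (n : nat) (x : R) : 0 <= 1 + x / n.+1%:R ->
  (1 + x / n.+1%:R) ^+ n.+1 <= expR x.
Proof.
move=> x0; have -> : expR x = expR (x / n.+1%:R) ^+ n.+1.
  by rewrite -expRM_natl mulrCA divff ?mulr1// pnatr_eq0.
by rewrite lerXn2r ?nnegrE ?expR_ge0// expR_ge1Dx.
Qed.

Lemma expR_N12 : expR (- 12) <= 10^-1 ^+ 5 :> R.
Proof.
rewrite exprVn expRN lef_pV2 ?posrE ?expR_gt0 ?exprn_gt0//.
have e1 : 263 / 100 <= expR 1 :> R.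
  by apply: le_trans (@expR_ge_pow 15 1 _); lra.
have -> : expR 12 = expR 1 ^+ 12 :> R by rewrite -expRM_natl mulr1.
apply: (@le_trans _ _ ((263 / 100) ^+ 12)); first by lra.
by rewrite lerXn2r ?nnegrE ?expR_ge0//; lra.
Qed.

Lemma off_point_dist K k y m : off_point K k y -> k%:R <= m <= k%:R + 2 / 10 ->
  exists2 d : nat, (0 < d)%N & 8 / 10 * d%:R <= `|y - m|.
Proof.
move=> [j [_ jk yj]] /andP[km mk].
have [jlt|klt] : (j < k)%N \/ (k < j)%N by apply/orP; rewrite -neq_ltn.
  exists (k - j)%N; first by rewrite subn_gt0.
  have : 1 <= (k - j)%:R :> R by rewrite ler1n subn_gt0.
  rewrite natrB ?(ltnW jlt)// => h.
  rewrite distrC ger0_norm; by case: yj => ->; lra.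
exists (j - k)%N; first by rewrite subn_gt0.
have : 1 <= (j - k)%:R :> R by rewrite ler1n subn_gt0.
rewrite natrB ?(ltnW klt)// => h.
by rewrite ger0_norm; case: yj => ->; lra.
Qed.

Lemma off_point_sqr_dist K k y m : off_point K k y ->
  k%:R <= m <= k%:R + 2 / 10 -> 64 / 100 <= (y - m) ^+ 2.
Proof.
move=> yoff mk; have [d d0 h] := off_point_dist yoff mk.
have d1 : 1 <= d%:R :> R by rewrite ler1n.
by rewrite -real_normK ?num_real//; nra.
Qed.

(** One factor exp D absorbs D = (y - m)^2. For a pair d steps away D >= 64/100 d^2, so exp (-19 D)
    <= exp (-12 d) <= q^d with q = 10^-5. With two points per pair the geometric sum is about 40 A q
    = A / 2500. *)
Lemma off_sum_leak K k (A m : R) (r : R -> R) :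
  0 <= A -> k%:R <= m <= k%:R + 2 / 10 ->
  (forall y, off_point K k y -> r y <= 10 * A * expR (- (20 * (y - m) ^+ 2))) ->
  off_sum K k (fun y => r y * (y - m) ^+ 2) <= A / 2000.
Proof.
move=> A0 mk rle.
pose q : R := 10^-1 ^+ 5.
have q0 : 0 <= q by rewrite /q; lra.
have pt j y : (1 <= j <= K)%N -> j != k -> y = j%:R \/ y = j%:R + 2 / 10 ->
    r y * (y - m) ^+ 2 <= 10 * A * q ^+ (maxn j k - minn j k).
  move=> jK jk yj; have yoff : off_point K k y by exists j.
  have D0 := sqr_ge0 (y - m).
  apply: (@le_trans _ _ (10 * A * expR (- (20 * (y - m) ^+ 2)) * (y - m) ^+ 2)).
    by rewrite ler_wpM2r ?rle.
  rewrite -mulrA ler_wpM2l ?mulr_ge0//.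
  have DE : (y - m) ^+ 2 <= expR ((y - m) ^+ 2).
    by apply: le_trans (expR_ge1Dx _); lra.
  apply: (@le_trans _ _ (expR (- (19 * (y - m) ^+ 2)))).
    have -> : - (19 * (y - m) ^+ 2) = - (20 * (y - m) ^+ 2) + (y - m) ^+ 2 by lra.
    by rewrite expRD ler_wpM2l// expR_ge0.
  set d := (maxn j k - minn j k)%N.
  have dD : d%:R * 12 <= 19 * (y - m) ^+ 2.
    have [j1 k1] := andP mk.
    have H (z : R) : 1 <= d%:R :> R -> 8 / 10 * d%:R <= z -> d%:R * 12 <= 19 * z ^+ 2.
      move=> d1 hz; have : (8 / 10 * d%:R) ^+ 2 <= z ^+ 2 by nra.
      by rewrite exprMn; nra.
    have [jlt|klt] : (j < k)%N \/ (k < j)%N by apply/orP; rewrite -neq_ltn.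
      have e : d%:R = k%:R - j%:R :> R.
        by rewrite /d (maxn_idPr (ltnW jlt)) (minn_idPl (ltnW jlt)) natrB// ltnW.
      have d1 : 1 <= d%:R :> R.
        by rewrite /d (maxn_idPr (ltnW jlt)) (minn_idPl (ltnW jlt)) ler1n subn_gt0.
      by rewrite -sqrrN; apply: H => //; case: yj => ->; lra.
    have e : d%:R = j%:R - k%:R :> R.
      by rewrite /d (maxn_idPl (ltnW klt)) (minn_idPr (ltnW klt)) natrB// ltnW.
    have d1 : 1 <= d%:R :> R.
      by rewrite /d (maxn_idPl (ltnW klt)) (minn_idPr (ltnW klt)) ler1n subn_gt0.
    by apply: H => //; case: yj => ->; lra.
  apply: (@le_trans _ _ (expR (- 12) ^+ d)).
    by rewrite -expRM_natl ler_expR; lra.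
  by rewrite lerXn2r ?nnegrE ?expR_ge0// expR_N12.
apply: (@le_trans _ _ (20 * A *
    \sum_(1 <= j < K.+1 | j != k) q ^+ (maxn j k - minn j k))).
  rewrite big_distrr/= /off_sum [leLHS]big_nat_cond [leRHS]big_nat_cond.
  apply: ler_sum => j /andP[jK jk].
  have := pt j j%:R jK jk (or_introl erefl).
  have := pt j (j%:R + 2 / 10) jK jk (or_intror erefl).
  by lra.
have := @sum_geometric_distance _ q K k q0; set S := \sum_(_ <= _ < _ | _) _.
move=> /(_ ltac:(rewrite /q; lra)); rewrite ler_pdivlMr; last by rewrite /q; lra.
rewrite /q => h; have S1 : S <= 21 * 10^-1 ^+ 6 by clear -h; lra.
have := ler_wpM2l A0 S1; clear -A0; move: S => S; lra.
Qed.

End Leakage.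

(** * A narrow component on one pair *)

Section FarPoint.
Context {R : realType}.
Implicit Types u e f : R.

(** Convexity: the exponential lies above its tangent at [y0], and [e0] is a rational stand-in for
    its value there. This reduces later estimates to polynomials. *)
Lemma expRN_tangent (e0 y0 y : R) : 0 <= e0 -> e0 <= expR (- y0) ->
  e0 * (1 + y0 - y) <= expR (- y).
Proof.
move=> e00 e0y; have [neg|pos] := leP (1 + y0 - y) 0.
  by apply: le_trans (expR_ge0 _); rewrite mulr_ge0_le0.
rewrite (_ : expR (- y) = expR (- y0) * expR (y0 - y)); last first.
  by rewrite -expRD; congr expR; ring.
apply: ler_pM => //; first exact: ltW.
by apply: le_trans (expR_ge1Dx _); lra.
Qed.

Lemma expRN_32_25 : 137 / 500 <= expR (- (32 / 25)) :> R.
Proof. by apply: le_trans (@expR_ge_pow R 63 _ _); lra. Qed.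

Lemma expRN_2 : 131 / 1000 <= expR (- 2) :> R.
Proof. by apply: le_trans (@expR_ge_pow R 63 _ _); lra. Qed.

(* On each subinterval [a, b], with h = u / 2 - 1 / 256, adding multiples of
   (u - a) (b - u) and h (u - a) (b - u) makes the cubic inequality linear. *)
Lemma far_gain_63 u : 87 / 200 <= u -> u <= 13 / 20 ->
  63 / 10 * (1 / 4 - (u / 2 - 1 / 256) ^+ 2) <=
  100 / 9 * (137 / 500 * (1 + 32 / 25 - 50 / 81 * (1 + u) ^+ 2) *
             (2 * (u / 2 - 1 / 256))).
Proof.
move=> ua ub.
have h0 : 0 <= u / 2 - 1 / 256 by lra.
have p0 : 0 <= (u - 87 / 200) * (13 / 20 - u) by apply: mulr_ge0; lra.
have p1 := mulr_ge0 h0 p0.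
lra.
Qed.

Lemma far_gain_70 u : 1 / 2 <= u -> u <= 13 / 20 ->
  7 * (1 / 4 - (u / 2 - 1 / 256) ^+ 2) <=
  100 / 9 * (137 / 500 * (1 + 32 / 25 - 50 / 81 * (1 + u) ^+ 2) *
             (2 * (u / 2 - 1 / 256))).
Proof.
move=> ua ub.
have h0 : 0 <= u / 2 - 1 / 256 by lra.
have p0 : 0 <= (u - 1 / 2) * (13 / 20 - u) by apply: mulr_ge0; lra.
have p1 := mulr_ge0 h0 p0.
lra.
Qed.

Lemma far_gain_70' u : 13 / 20 <= u -> u <= 1 ->
  7 * (1 / 4 - (u / 2 - 1 / 256) ^+ 2) <=
  100 / 9 * (131 / 1000 * (3 - 50 / 81 * (1 + u) ^+ 2) *
             (2 * (u / 2 - 1 / 256))).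
Proof.
move=> ua ub.
have h0 : 0 <= u / 2 - 1 / 256 by lra.
have p0 : 0 <= (u - 13 / 20) * (1 - u) by apply: mulr_ge0; lra.
have p1 := mulr_ge0 h0 p0.
lra.
Qed.

(** Here [g / d] is the least excess of the competing density that a collapse with asymmetry [u]
    would require. The tangent points 32/25 and 2 serve the ranges below and above u = 13/20. *)
Lemma far_gain u : 87 / 200 <= u -> u <= 1 ->
  let g := 100 / 9 * expR (- (50 / 81 * (1 + u) ^+ 2)) *
           (2 * (u / 2 - 1 / 256)) in
  let d := 1 / 4 - (u / 2 - 1 / 256) ^+ 2 in
  63 / 10 * d <= g /\ (1 / 2 <= u -> 7 * d <= g).
Proof.
move=> ua ub g d.
have h0 : 0 <= 2 * (u / 2 - 1 / 256) by lra.
have d0 : 0 <= d by rewrite /d; nra.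
have lift (e0 y0 c : R) : 0 <= e0 -> e0 <= expR (- y0) ->
    c <= 100 / 9 * (e0 * (1 + y0 - 50 / 81 * (1 + u) ^+ 2) *
                    (2 * (u / 2 - 1 / 256))) -> c <= g.
  move=> e00 e0y /le_trans; apply; rewrite /g -[leRHS]mulrA ler_pM2l;
    last by clear; lra.
  by rewrite ler_wpM2r// expRN_tangent.
have [uc|uc] := leP u (13 / 20).
  split.
    by apply: (lift _ _ _ _ expRN_32_25 (far_gain_63 ua uc)); lra.
  by move=> u2; apply: (lift _ _ _ _ expRN_32_25 (far_gain_70 u2 uc)); lra.
have g7 : 7 * d <= g.
  apply: (lift _ _ _ _ expRN_2); first by lra.
  by have := far_gain_70' (ltW uc) ub; rewrite (_ : 1 + 2 = 3)//; lra.
by split=> //; lra.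
Qed.

(* Excludes the lower face s = 9/100. Up to the leakage 1/256, stationarity in
   the mean makes the responsibilities at distances e and f proportional to f
   and e. If e f <= s^2, this ratio exceeds the one allowed by the weights cf
   and cn of the other component at the two points. *)
Lemma pair_not_collapsing (e f A cf cn : R) :
  let Nf := gden (9 / 100) 0 f in let Nn := gden (9 / 100) 0 e in
  0 <= e -> e <= f -> e + f = 2 / 10 -> e * f <= (9 / 100) ^+ 2 ->
  0 < A -> 0 < cf -> 0 < cn ->
  A * Nf / (A * Nf + cf) <= A * (5 * e + 1 / 256) ->
  A * (5 * f - 1 / 256) <= A * Nn / (A * Nn + cn) ->
  cf <= 73 / 10 ->
  cf <= 597 / 100 \/ cf * expR (- (1 / 2)) <= cn -> False.
Proof.
move=> Nf Nn e0 ef sum_ef prod_ef A0 cf0 cn0.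
(* [u] is the asymmetry (f - e) / (e + f), and [h] is half of it less the leakage, so the two bounds
   on the responsibilities become [A * (1 / 2 - h)] and [A * (1 / 2 + h)]. *)
pose u := 10 * f - 1; pose h := u / 2 - 1 / 256.
have fE : f = (1 + u) / 10 by rewrite /u; field.
have eE : e = (1 - u) / 10 by rewrite /u; move: sum_ef; clear; lra.
have u1 : u <= 1 by move: eE e0; clear; lra.
have u0 : 0 <= u by move: eE fE ef; clear; lra.
(* The product bound says 1 - u^2 <= 81/100, and the square of 87/200 is just below 19/100. *)
have ul : 87 / 200 <= u.
  rewrite leNgt; apply/negP => lt.
  have := ler_pM u0 u0 (ltW lt) (ltW lt).
  by move: prod_ef; rewrite fE eE; clear; lra.
move=> {e0 ef sum_ef prod_ef} rf rn cf73 alt.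
pose E := expR (- (50 / 81 * (1 + u) ^+ 2)); pose z := expR (- (200 / 81 * u)).
have NfE : Nf = 100 / 9 * E.
  rewrite /Nf /gden /E subr0 fE invf_div; congr (_ * expR (- _)).
  by field.
have NnE : Nf = Nn * z.
  rewrite NfE /Nn /gden subr0 invf_div.
  rewrite (_ : E = expR (- (e ^+ 2 / (2 * (9 / 100) ^+ 2))) * z) ?mulrA//.
  by rewrite /E /z -expRD eE; congr expR; field.
have Nf0 : 0 < Nf by rewrite gden_gt0//; lra.
have Nn0 : 0 < Nn by rewrite gden_gt0//; lra.
have z0 : 0 < z by exact: expR_gt0.
have rf' : Nf <= (1 / 2 - h) * (A * Nf + cf).
  move: rf; rewrite -mulrA ler_pM2l// ler_pdivrMr; last first.
    by apply: addr_gt0 => //; exact: mulr_gt0.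
  by rewrite (_ : 5 * e + 1 / 256 = 1 / 2 - h)// /h eE; field.
have rn' : (1 / 2 + h) * (A * Nn + cn) <= Nn.
  move: rn; rewrite -mulrA ler_pM2l// ler_pdivlMr; last first.
    by apply: addr_gt0 => //; exact: mulr_gt0.
  by rewrite (_ : 5 * f - 1 / 256 = 1 / 2 + h)// /h fE; field.
have rn'' : (1 / 2 + h) * (A * Nf + cn * z) <= Nf.
  by rewrite NnE [A * _]mulrA -mulrDl mulrA ler_pM2r.
have P0 : 0 < 1 / 2 - h by rewrite /h; clear -u1; lra.
have Q0 : 0 < 1 / 2 + h by rewrite /h; clear -u0; lra.
(* Multiplying each inequality by the other's coefficient and subtracting eliminates the unknown
   weight [A]. *)
have key : Nf * (2 * h) <= (1 / 4 - h ^+ 2) * (cf - cn * z).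
  have := ler_wpM2l (ltW Q0) rf'; have := ler_wpM2l (ltW P0) rn''.
  by move: (Nf) (cn * z) => N w; clear; lra.
have d0 : 0 < 1 / 4 - h ^+ 2.
  by have := mulr_gt0 P0 Q0; clear; lra.
have [g63 g70] := far_gain ul u1.
rewrite -/E -NfE -/h in g63 g70.
have low (c : R) : c * (1 / 4 - h ^+ 2) <= Nf * (2 * h) -> c <= cf - cn * z.
  by move=> /le_trans/(_ key); rewrite mulrC ler_pM2l.
have {}g63 := low _ g63.
case: alt => [cf5|cnf]; first by have := mulr_gt0 cn0 z0; move: g63 cf5; clear; lra.
have cnz : cf * expR (- (1 / 2) - 200 / 81 * u) <= cn * z.
  by rewrite expRD mulrA ler_pM2r.
(* The competitor at the near point removes at least a fraction 42/1000, or 14/100 when u <= 1/2, of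
   [cf]. From 73/10 this leaves less than 7, respectively less than 63/10. *)
have [u2|u2] := leP (1 / 2) u.
  have {}g70 := low _ (g70 u2).
  have w0 : 42 / 1000 <= expR (- (1 / 2) - 200 / 81 * u).
    apply: (@le_trans _ _ (expR (- (297 / 100)))); last first.
      by rewrite ler_expR; clear -u1; lra.
    by clear; apply: le_trans (@expR_ge_pow R 31 _ _); lra.
  have := ler_wpM2l (ltW cf0) w0.
  by move: g70 cnz cf73; clear; lra.
have w0 : 14 / 100 <= expR (- (1 / 2) - 200 / 81 * u).
  apply: (@le_trans _ _ (expR (- (87 / 50)))); last first.
    by rewrite ler_expR; clear -u2; lra.
  by clear; apply: le_trans (@expR_ge_pow R 15 _ _); lra.
have := ler_wpM2l (ltW cf0) w0.
by move: g63 cnz cf73; clear; lra.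
Qed.

End FarPoint.

(** * One narrow component against an abstract competing density *)

Section Component.
Context {R : realType}.

Lemma off_point_cases K k (y : R) : off_point K k y ->
  y <= k%:R - 8 / 10 \/ k%:R + 1 <= y.
Proof.
move=> [j [_ jk yj]].
have [jlt|klt] : (j < k)%N \/ (k < j)%N by apply/orP; rewrite -neq_ltn.
  have : j.+1%:R <= k%:R :> R by rewrite ler_nat.
  by rewrite -natr1; left; case: yj => ->; lra.
have : k.+1%:R <= j%:R :> R by rewrite ler_nat.
by rewrite -natr1; right; case: yj => ->; lra.
Qed.

(** The prefactor is taken at the largest [s] and the exponent at the smallest: 50/81 * 100 is 1 /
    (2 s^2) for s = 9/100. *)
Lemma gden_lower (s m y D : R) : 9 / 100 <= s -> s <= 21 / 200 ->
  (y - m) ^+ 2 <= D ->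
  200 / 21 * expR (- (D * (50 / 81 * 100))) <= gden s m y.
Proof.
move=> s1 s2 yD; have s0 : 0 < s by lra.
apply: ler_pM; [by clear; lra|exact: expR_ge0| |].
  by rewrite -[leRHS]div1r ler_pdivlMr; [move: s2; clear; lra|exact: s0].
rewrite ler_expR lerN2 ler_pdivrMr; last by rewrite mulr_gt0 ?exprn_gt0.
have D0 : 0 <= D by apply: le_trans yD; exact: sqr_ge0.
apply: le_trans yD _; rewrite -[leRHS]mulrA ler_peMr//.
have p9 : 0 <= 9 / 100 :> R by clear; lra.
by have := ler_pM p9 p9 s1 s1; clear; lra.
Qed.

Lemma sqr_le_dist (d t : R) : - d <= t -> t <= d -> t ^+ 2 <= d ^+ 2.
Proof. by move=> h1 h2; rewrite -subr_ge0 subr_sqr mulr_ge0; lra. Qed.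

(** A responsibility with the competing density abstract, so that the same estimates serve a broad
    competitor and, for two pairs, either narrow component. *)
Definition cresp (A m s : R) (c : R -> R) (y : R) : R :=
  A * gden s m y / (A * gden s m y + c y).

(* A is 2K times the mixing weight of the component, c is 2K times the weighted
   density of the other component; as in gden, the factor 1 / sqrt (2 pi) is
   dropped from both. *)
Record on_pair (K k : nat) (A m s : R) (c : R -> R) : Prop := OnPair {
  on_pair_index : (1 <= k <= K)%N;
  on_pair_weight_gt0 : 0 < A;
  on_pair_weight_le : A <= 5 / 2;
  on_pair_mean_ge : k%:R <= m;
  on_pair_mean_le : m <= k%:R + 2 / 10;
  on_pair_sd_ge : 9 / 100 <= s;
  on_pair_sd_le : s <= 21 / 200;
  on_pair_other_gt0 : forall y, 0 < c y;
  on_pair_leak :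
    off_sum K k (fun y => cresp A m s c y * (y - m) ^+ 2) <= A / 2000;
  on_pair_other_left : c k%:R <= 73 / 10;
  on_pair_other_right : c (k%:R + 2 / 10) <= 73 / 10
}.

Lemma cresp_gt0 (A m s : R) (c : R -> R) y :
  0 < A -> 0 < s -> 0 < c y -> 0 < cresp A m s c y.
Proof.
move=> A0 s0 c0; have N0 : 0 < A * gden s m y by rewrite mulr_gt0 ?gden_gt0.
by rewrite divr_gt0// addr_gt0.
Qed.

Lemma cresp_lt1 (A m s : R) (c : R -> R) y :
  0 < A -> 0 < s -> 0 < c y -> cresp A m s c y < 1.
Proof.
move=> A0 s0 c0; have N0 : 0 < A * gden s m y by rewrite mulr_gt0 ?gden_gt0.
by rewrite ltr_pdivrMr ?addr_gt0// mul1r ltrDl.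
Qed.

Lemma off_sum_bound K k (A m s : R) (c : R -> R) (F : R -> R) :
  on_pair K k A m s c ->
  (forall y, off_point K k y -> F y <= 25 / 16 * (y - m) ^+ 2) ->
  off_sum K k (fun y => cresp A m s c y * F y) <= A / 1280.
Proof.
move=> hp; set x2 : R := k%:R + 2 / 10; set x1 : R := k%:R.
set r := cresp A m s c; have [hk A0 A25 m1 m2 s1 s2 c0 leak c1 c2] := hp.
have s0 : 0 < s by move: s1; clear; lra.
move=> Fle; apply: (@le_trans _ _ (25 / 16 * (A / 2000))).
  rewrite -(ler_pM2l (_ : 0 < 25 / 16 :> R)) in leak; last by lra.
  apply: le_trans leak; rewrite -off_sumZ; apply: off_sum_le => y /Fle h.
  by rewrite [leRHS]mulrCA ler_wpM2l// ltW// cresp_gt0.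
by rewrite le_eqVlt; apply/orP; left; apply/eqP; field.
Qed.

(** 25/16 is the inverse square of 8/10, the least distance t from [m] to another pair, and t + 2/10
    <= 25/16 t^2 holds from there on, with equality at 8/10. The product is nonnegative because no
    other sample point lies between the two points of the pair. *)
Lemma off_point_sqr_ge K k (A m s : R) (c : R -> R) y :
  on_pair K k A m s c -> off_point K k y ->
  let x1 : R := k%:R in let x2 : R := k%:R + 2 / 10 in
  [/\ 1 <= 25 / 16 * (y - m) ^+ 2, `|y - x1| <= 25 / 16 * (y - m) ^+ 2,
      `|y - x2| <= 25 / 16 * (y - m) ^+ 2 &
      0 <= (y - x1) * (y - x2) <= 25 / 16 * (y - m) ^+ 2].
Proof.
case=> _ _ _ zm mz _ _ _ _ _ _ /off_point_cases cases x1 x2.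
move: zm mz cases; rewrite /x1 /x2; clear; move: (k%:R : R) => z zm mz cases.
have [t [t8 sqrE n1 n2 pr]] : exists t, [/\ 8 / 10 <= t, (y - m) ^+ 2 = t ^+ 2,
    `|y - z| <= t + 2 / 10, `|y - (z + 2 / 10)| <= t + 2 / 10 &
    0 <= (y - z) * (y - (z + 2 / 10)) <= (t + 2 / 10) * t].
  case: cases => [yz|yz].
    exists (m - y); split; [lra|by rewrite -sqrrN opprB| | |].
    - by rewrite ler0_norm; lra.
    - by rewrite ler0_norm; lra.
    - have -> : (y - z) * (y - (z + 2 / 10)) = (z + 2 / 10 - y) * (z - y) by ring.
      apply/andP; split; first by apply: mulr_ge0; lra.
      by apply: ler_pM; lra.
  exists (y - m); split; [lra|by []| | |].
  - by rewrite ger0_norm; lra.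
  - by rewrite ger0_norm; lra.
  - apply/andP; split; first by apply: mulr_ge0; lra.
    by apply: ler_pM; lra.
have t0 : 0 <= t by move: t8; clear; lra.
have t1 : 0 <= t - 8 / 10 by rewrite subr_ge0.
have tt := mulr_ge0 t0 t1; move: t8 n1 n2 pr tt; rewrite sqrE; clear.
move=> t8 n1 n2 /andP[p0 p1] tt; split; [lra| | |].
- by apply: le_trans n1 _; lra.
- by apply: le_trans n2 _; lra.
- by rewrite p0/=; apply: le_trans p1 _; lra.
Qed.

Lemma off_resp_le K k (A m s : R) (c : R -> R) :
  on_pair K k A m s c ->
  off_sum K k (cresp A m s c) <= A / 1280.
Proof.
move=> hp; set x2 : R := k%:R + 2 / 10; set x1 : R := k%:R.
set r := cresp A m s c; have [hk A0 A25 m1 m2 s1 s2 c0 leak c1 c2] := hp.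
have s0 : 0 < s by move: s1; clear; lra.
rewrite (_ : off_sum K k r = off_sum K k (fun y => r y * 1)).
  by apply: (off_sum_bound hp) => y /(off_point_sqr_ge hp)[].
by apply: eq_bigr => j _; rewrite !mulr1.
Qed.

Lemma off_moment_abs K k (A m s : R) (c : R -> R) (x0 : R) :
  on_pair K k A m s c ->
  x0 = k%:R \/ x0 = (k%:R + 2 / 10) ->
  `|off_sum K k (fun y => cresp A m s c y * (y - x0))| <= A / 1280.
Proof.
move=> hp; set x2 : R := k%:R + 2 / 10; set x1 : R := k%:R.
set r := cresp A m s c; have [hk A0 A25 m1 m2 s1 s2 c0 leak c1 c2] := hp.
have s0 : 0 < s by move: s1; clear; lra.
move=> x0E; have H y : off_point K k y -> `|y - x0| <= 25 / 16 * (y - m) ^+ 2.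
  by move=> /(off_point_sqr_ge hp)[_ h1 h2 _]; case: x0E => ->.
rewrite ler_norml; apply/andP; split.
  rewrite lerNl -mulN1r -off_sumZ.
  rewrite (_ : off_sum K k _ = off_sum K k (fun y => r y * - (y - x0))).
    apply: (off_sum_bound hp) => y /H; apply: le_trans.
    by rewrite -normrN; exact: ler_norm.
  by apply: eq_bigr => j _; rewrite !mulN1r !mulrN.
by apply: (off_sum_bound hp) => y /H; apply: le_trans; exact: ler_norm.
Qed.

Lemma off_product K k (A m s : R) (c : R -> R) :
  on_pair K k A m s c ->
  let L := off_sum K k (fun y =>
    cresp A m s c y * ((y - k%:R) * (y - (k%:R + 2 / 10)))) in
  0 <= L /\ L <= A / 1280.
Proof.
move=> hp; set x2 : R := k%:R + 2 / 10; set x1 : R := k%:R.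
set r := cresp A m s c; have [hk A0 A25 m1 m2 s1 s2 c0 leak c1 c2] := hp.
have s0 : 0 < s by move: s1; clear; lra.
split; last by apply: (off_sum_bound hp) => y /(off_point_sqr_ge hp)[_ _ _ /andP[]].
apply: off_sum_ge0 => y /(off_point_sqr_ge hp)[_ _ _ /andP[h _]].
by rewrite mulr_ge0// ltW// cresp_gt0.
Qed.

Lemma comp_total_le K k (A m s : R) (c : R -> R) :
  on_pair K k A m s c ->
  pair_sum K (cresp A m s c) <= 2 + A / 1280.
Proof.
move=> hp; set x2 : R := k%:R + 2 / 10; set x1 : R := k%:R.
set r := cresp A m s c; have [hk A0 A25 m1 m2 s1 s2 c0 leak c1 c2] := hp.
have s0 : 0 < s by move: s1; clear; lra.
rewrite (pair_sumD1 _ hk).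
have := off_resp_le hp.
have := cresp_lt1 m A0 s0 (c0 x1); have := cresp_lt1 m A0 s0 (c0 x2).
rewrite -/r.
by rewrite /x1 /x2; move: (r _) (r _) (off_sum _ _ _) => a b d; clear; lra.
Qed.

(** If the mean sits at one end of the pair, the other point pulls it inward by at least 2/10 * A/20
    = A/100, which beats the leakage A/1280. *)
Lemma resp_pair_ge K k (A m s : R) (c : R -> R) y :
  on_pair K k A m s c ->
  k%:R <= y -> y <= k%:R + 2 / 10 -> c y <= 73 / 10 ->
  A / 20 <= cresp A m s c y.
Proof.
move=> hp; set x2 : R := k%:R + 2 / 10; set x1 : R := k%:R.
set r := cresp A m s c; have [hk A0 A25 m1 m2 s1 s2 c0 leak c1 c2] := hp.
have s0 : 0 < s by move: s1; clear; lra.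
move=> y1 y2 cy.
have N0 : 0 < gden s m y by exact: gden_gt0.
have Ny : 6 / 10 <= gden s m y.
  have yd : (y - m) ^+ 2 <= (2 / 10) ^+ 2.
    by apply: sqr_le_dist; move: m1 m2 y1 y2; rewrite /x1 /x2; clear; lra.
  apply: le_trans (gden_lower s1 s2 yd).
  have : 65 / 1000 <= expR (- ((2 / 10) ^+ 2 * (50 / 81 * 100))) :> R.
    by clear; apply: le_trans (@expR_ge_pow R 15 _ _); lra.
  by clear; move: (expR _) => z; lra.
rewrite /r /cresp -mulrA ler_pM2l// ler_pdivlMr; last first.
  by rewrite addr_gt0// mulr_gt0.
have := ler_wpM2r (ltW N0) A25.
by move: Ny cy; clear; lra.
Qed.

Lemma comp_mean_interior K k (A m s : R) (c : R -> R) :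
  on_pair K k A m s c ->
  face_cond k%:R (k%:R + 2 / 10) m
    (pair_sum K (fun y => cresp A m s c y * (y - m))) ->
  k%:R < m /\ m < k%:R + 2 / 10.
Proof.
move=> hp; set x2 : R := k%:R + 2 / 10; set x1 : R := k%:R.
set r := cresp A m s c; have [hk A0 A25 m1 m2 s1 s2 c0 leak c1 c2] := hp.
have s0 : 0 < s by move: s1; clear; lra.
have x12 : x1 < x2 by rewrite /x1 /x2; clear; lra.
move=> [F1 F2]; split; rewrite lt_neqAle ?m1 ?m2 andbT; apply/eqP => e.
- have /F2 : m < x2 by rewrite -e.
  rewrite (pair_sumD1 _ hk) -/x1 -/x2 -e subrr mulr0 add0r.
  have := off_moment_abs hp (or_introl erefl); rewrite ler_norml => /andP[h _].
  have : A / 20 <= r x2 by apply: (resp_pair_ge hp) => //; exact: ltW.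
  move: h A0; rewrite (_ : x2 - x1 = 2 / 10); last by rewrite /x1 /x2; ring.
  by move: (off_sum _ _ _) (r x2) => a b; clear; lra.
- have /F1 : x1 < m by rewrite e.
  rewrite (pair_sumD1 _ hk) -/x1 -/x2 e subrr mulr0 addr0.
  have := off_moment_abs hp (or_intror erefl); rewrite ler_norml => /andP[_ h].
  have : A / 20 <= r x1 by apply: (resp_pair_ge hp) => //; exact: ltW.
  move: h A0; rewrite (_ : x1 - x2 = - (2 / 10)); last by rewrite /x1 /x2; ring.
  by move: (off_sum _ _ _) (r x1) => a b; clear; lra.
Qed.

(** (y - m)^2 is (y - x1)(y - x2) plus a multiple of y - m plus the constant (m - x1)(x2 - m). The
    product vanishes on the pair and stationarity in the mean kills the linear part, so only leakage
    perturbs the comparison of s^2 with (m - x1)(x2 - m). *)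
Lemma comp_second_moment K k (A m s : R) (c : R -> R) :
  on_pair K k A m s c ->
  pair_sum K (cresp A m s c) = A ->
  pair_sum K (fun y => cresp A m s c y * (y - m)) = 0 ->
  pair_sum K (fun y => cresp A m s c y * ((y - m) ^+ 2 - s ^+ 2)) =
  off_sum K k (fun y => cresp A m s c y * ((y - k%:R) * (y - (k%:R + 2 / 10))))
  + ((m - k%:R) * ((k%:R + 2 / 10) - m) - s ^+ 2) * A.
Proof.
move=> hp; set x2 : R := k%:R + 2 / 10; set x1 : R := k%:R.
set r := cresp A m s c.
have [hk A0 A25 m1 m2 s1 s2 c0 leak c1 c2] := hp => total mean.
have s0 : 0 < s by move: s1; clear; lra.
rewrite (_ : pair_sum K _ = pair_sum K (fun y =>
  r y * ((y - x1) * (y - x2)) + ((x1 + x2 - 2 * m) * (r y * (y - m)) +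
  ((m - x1) * (x2 - m) - s ^+ 2) * r y))).
  rewrite !pair_sumD !pair_sumZ mean total mulr0 add0r; congr (_ + _).
  by rewrite (pair_sumD1 _ hk) -/x1 -/x2 !subrr mul0r !mulr0 !add0r.
apply: pair_sum_ext => y; ring.
Qed.

Lemma comp_sd_lt K k (A m s : R) (c : R -> R) :
  on_pair K k A m s c ->
  pair_sum K (cresp A m s c) = A ->
  pair_sum K (fun y => cresp A m s c y * (y - m)) = 0 ->
  (9 / 100 < s -> 0 <= pair_sum K (fun y =>
    cresp A m s c y * ((y - m) ^+ 2 - s ^+ 2))) ->
  s < 21 / 200.
Proof.
move=> hp; set x2 : R := k%:R + 2 / 10; set x1 : R := k%:R.
set r := cresp A m s c.
have [hk A0 A25 m1 m2 s1 s2 c0 leak c1 c2] := hp => total mean.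
have s0 : 0 < s by move: s1; clear; lra.
move=> F; rewrite lt_neqAle s2 andbT; apply/eqP => e.
have := F ltac:(rewrite e; lra); rewrite (comp_second_moment hp total mean).
have [_] := off_product hp; move: (off_sum _ _ _) => o L.
(* Arithmetic-geometric mean inequality. The gap between 1/100 and the square of 21/200 exceeds the
   leakage 1/1280. *)
have : (m - x1) * (x2 - m) <= 1 / 100.
  have := sqr_ge0 (m - x1 - (x2 - m)).
  have : (m - x1) + (x2 - m) = 2 / 10 by rewrite /x2 /x1; ring.
  move: (m - x1) (x2 - m) => p q pq pq0.
  have -> : p * q = ((p + q) ^+ 2 - (p - q) ^+ 2) / 4 by field.
  by move: pq0; rewrite pq; clear; lra.
rewrite e; move: ((m - x1) * _) => w w1.
have := ler_wpM2r (ltW A0) w1.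
by move: L A0; clear; lra.
Qed.

(** Taking the first moment about one point of the pair isolates the responsibility of the other.
    Division by 2/10 turns the leakage A/1280 into A/256. *)
Lemma comp_first_moments K k (A m s : R) (c : R -> R) :
  on_pair K k A m s c ->
  pair_sum K (cresp A m s c) = A ->
  pair_sum K (fun y => cresp A m s c y * (y - m)) = 0 ->
  `|cresp A m s c (k%:R + 2 / 10) - A * (5 * (m - k%:R))| <= A / 256 /\
  `|cresp A m s c k%:R - A * (5 * ((k%:R + 2 / 10) - m))| <= A / 256.
Proof.
move=> hp; set x2 : R := k%:R + 2 / 10; set x1 : R := k%:R.
set r := cresp A m s c.
have [hk A0 A25 m1 m2 s1 s2 c0 leak c1 c2] := hp => total mean.
have s0 : 0 < s by move: s1; clear; lra.
have E x0 : pair_sum K (fun y => r y * (y - x0)) = A * (m - x0).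
  rewrite (_ : pair_sum K _ = pair_sum K (fun y => r y * (y - m) + (m - x0) * r y)).
    by rewrite pair_sumD pair_sumZ mean total add0r mulrC.
  by apply: pair_sum_ext => y; ring.
split.
  have := E x1; rewrite (pair_sumD1 _ hk) -/x1 -/x2 subrr mulr0 add0r.
  have := off_moment_abs hp (or_introl erefl).
  rewrite !ler_norml (_ : x2 - x1 = 2 / 10); last by rewrite /x1 /x2; ring.
  move: (off_sum _ _ _) (r x2) (m - x1) => a b w; clear.
  by move=> /andP[? ?] ?; apply/andP; split; lra.
have := E x2; rewrite (pair_sumD1 _ hk) -/x1 -/x2 subrr mulr0 addr0.
have := off_moment_abs hp (or_intror erefl).
rewrite !ler_norml (_ : x1 - x2 = - (2 / 10)); last by rewrite /x1 /x2; ring.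
rewrite -[x2 - m]opprB; move: (off_sum _ _ _) (r x1) (m - x2) => a b w; clear.
by move=> /andP[? ?] ?; apply/andP; split; lra.
Qed.

Lemma comp_sd_gt K k (A m s : R) (c : R -> R) :
  on_pair K k A m s c ->
  pair_sum K (cresp A m s c) = A ->
  pair_sum K (fun y => cresp A m s c y * (y - m)) = 0 ->
  c k%:R <= 597 / 100 \/ c k%:R * expR (- (1 / 2)) <= c (k%:R + 2 / 10) ->
  c (k%:R + 2 / 10) <= 597 / 100 \/
    c (k%:R + 2 / 10) * expR (- (1 / 2)) <= c k%:R ->
  (s < 21 / 200 -> pair_sum K (fun y =>
    cresp A m s c y * ((y - m) ^+ 2 - s ^+ 2)) <= 0) ->
  9 / 100 < s.
Proof.
move=> hp; set x2 : R := k%:R + 2 / 10; set x1 : R := k%:R.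
set r := cresp A m s c.
have [hk A0 A25 m1 m2 s1 s2 c0 leak c1 c2] := hp => total mean.
have s0 : 0 < s by move: s1; clear; lra.
move=> alt1 alt2 F; rewrite lt_neqAle s1 andbT; apply/eqP => e.
have [M2 M1] := comp_first_moments hp total mean.
rewrite -/x2 -/x1 -/r in M1 M2.
have := F ltac:(rewrite -e; lra); rewrite (comp_second_moment hp total mean).
have [+ _] := off_product hp; move: (off_sum _ _ _) => o L.
rewrite -/x2 -/x1 -e => o0.
have {L o0} h : (m - x1) * (x2 - m) <= (9 / 100) ^+ 2.
  by rewrite -(ler_pM2r A0); move: o0 L; clear; lra.
have ef : (m - x1) + (x2 - m) = 2 / 10 by rewrite /x2 /x1; ring.
have Nf : gden s m x2 = gden (9 / 100) 0 (x2 - m) by rewrite /gden e subr0.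
have Nn : gden s m x1 = gden (9 / 100) 0 (m - x1).
  by rewrite /gden e subr0 -sqrrN opprB.
have e0 : 0 <= m - x1 by rewrite subr_ge0.
have f0 : 0 <= x2 - m by rewrite subr_ge0.
move: M1 M2; rewrite /r /cresp !ler_norml Nf Nn => /andP[M1 M1'] /andP[M2 M2'].
(* The point farther from the mean plays the role of [f]; either may be, hence the two symmetric
   alternatives in the hypotheses. *)
have [le|/ltW le] := leP (m - x1) (x2 - m).
  apply: (pair_not_collapsing e0 le ef h A0 (c0 x2) (c0 x1)) => //.
    by move: M2'; clear; move: (A * gden _ _ _ / _) => z; lra.
  by move: M1; clear; move: (A * gden _ _ _ / _) => z; lra.
rewrite addrC in ef; rewrite mulrC in h.
apply: (pair_not_collapsing f0 le ef h A0 (c0 x1) (c0 x2)) => //.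
  by move: M1'; clear; move: (A * gden _ _ _ / _) => z; lra.
by move: M2; clear; move: (A * gden _ _ _ / _) => z; lra.
Qed.

End Component.

(** * From box maxima to critical points *)

Section Assembly.
Context {R : realType}.

Lemma exists_nontrivial K (x : nat -> R)
    (la ha lm1 hm1 lm2 hm2 ls1 hs1 ls2 hs2 : R) :
  (forall j, (1 <= j <= K)%N ->
    x (2 * j - 1)%N = j%:R /\ x (2 * j)%N = j%:R + 2 / 10) ->
  0 < la -> la <= ha -> ha < 1 -> lm1 <= hm1 -> lm2 <= hm2 ->
  0 < ls1 -> ls1 <= hs1 -> 0 < ls2 -> ls2 <= hs2 ->
  (forall a m1 m2 s1 s2, let r := resp a m1 m2 s1 s2 in
    in_box (a, m1, m2, s1, s2) (la, lm1, lm2, ls1, ls2)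
      (ha, hm1, hm2, hs1, hs2) ->
    face_cond la ha a (pair_sum K (fun y => r y - a)) ->
    face_cond lm1 hm1 m1 (pair_sum K (fun y => r y * (y - m1))) ->
    face_cond lm2 hm2 m2 (pair_sum K (fun y => (1 - r y) * (y - m2))) ->
    face_cond ls1 hs1 s1
      (pair_sum K (fun y => r y * ((y - m1) ^+ 2 - s1 ^+ 2))) ->
    face_cond ls2 hs2 s2
      (pair_sum K (fun y => (1 - r y) * ((y - m2) ^+ 2 - s2 ^+ 2))) ->
    [/\ la < a < ha, lm1 < m1 < hm1, lm2 < m2 < hm2, ls1 < s1 < hs1 &
        ls2 < s2 < hs2] /\ (m1, s1) <> (m2, s2)) ->
  exists a m1 m2 s1 s2 : R,
    nontrivial_critical_point (loglik (2 * K) x) (a, m1, m2, s1, s2) /\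
    lm1 < m1 < hm1.
Proof.
move=> hx la0 laha ha1 m1lh m2lh s1l0 s1lh s2l0 s2lh interior.
have [a [m1 [m2 [s1 [s2 [bx [Fa F1 F2 T1 T2]]]]]]] :=
  exists_box_max (2 * K) x la0 laha ha1 m1lh m2lh s1l0 s1lh s2l0 s2lh.
set r := resp a m1 m2 s1 s2 in Fa F1 F2 T1 T2.
rewrite (sample_sum (fun y => r y - a) hx) in Fa.
rewrite (sample_sum (fun y => r y * (y - m1)) hx) in F1.
rewrite (sample_sum (fun y => (1 - r y) * (y - m2)) hx) in F2.
rewrite (sample_sum (fun y => r y * ((y - m1) ^+ 2 - s1 ^+ 2)) hx) in T1.
rewrite (sample_sum (fun y => (1 - r y) * ((y - m2) ^+ 2 - s2 ^+ 2)) hx) in T2.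
have [[/andP[a1 a2] /andP[b1 b2] /andP[c1 c2] /andP[d1 d2] /andP[e1 e2]] ne] :=
  interior _ _ _ _ _ bx Fa F1 F2 T1 T2.
have a01 : 0 < a < 1 by rewrite (lt_trans la0)//= (lt_trans a2).
have s10 : 0 < s1 by exact: lt_trans d1.
have s20 : 0 < s2 by exact: lt_trans e1.
exists a, m1, m2, s1, s2; split; last by rewrite b1 b2.
split; last exact: mixture_not_gaussian.
apply: critical_point_loglik => //.
- by rewrite (sample_sum (fun y => r y - a) hx) (face_cond_interior Fa).
- by rewrite (sample_sum (fun y => r y * (y - m1)) hx) (face_cond_interior F1).
- by rewrite (sample_sum (fun y => (1 - r y) * (y - m2)) hx)
    (face_cond_interior F2).
- by rewrite (sample_sum (fun y => r y * ((y - m1) ^+ 2 - s1 ^+ 2)) hx)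
    (face_cond_interior T1).
- by rewrite (sample_sum (fun y => (1 - r y) * ((y - m2) ^+ 2 - s2 ^+ 2)) hx)
    (face_cond_interior T2).
Qed.

Definition other_weight K (a m s y : R) : R := 2 * K%:R * (1 - a) * gden s m y.

Lemma respE K (a m1 m2 s1 s2 y : R) : (0 < K)%N ->
  resp a m1 m2 s1 s2 y =
  cresp (2 * K%:R * a) m1 s1 (other_weight K a m2 s2) y.
Proof.
move=> K0; have k0 : 2 * K%:R != 0 :> R by rewrite mulf_neq0// pnatr_eq0 -?lt0n.
rewrite /resp /cresp /other_weight /gmix; move: (2 * K%:R) k0 => n n0.
rewrite -(mulrA n a) -(mulrA n (1 - a)) -mulrDr invfM.
by rewrite mulrACA divff// mul1r.
Qed.

(** At the largest admissible [s], 1 / (2 s^2) is still above 45. *)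
Lemma gden_upper (s m y D : R) : 9 / 100 <= s -> s <= 21 / 200 ->
  0 <= D -> D <= (y - m) ^+ 2 -> gden s m y <= 100 / 9 * expR (- (45 * D)).
Proof.
move=> s1 s2 D0 yD; have s0 : 0 < s by move: s1; clear; lra.
apply: ler_pM; [by rewrite invr_ge0 ltW|exact: expR_ge0| |].
  by rewrite -[leLHS]div1r ler_pdivrMr; [move: s1; clear; lra|exact: s0].
rewrite ler_expR lerN2 ler_pdivlMr; last by rewrite mulr_gt0 ?exprn_gt0.
apply: le_trans yD; rewrite mulrAC ler_piMl//.
have := ler_pM (ltW s0) (ltW s0) s2 s2.
by clear; lra.
Qed.

Lemma cresp_le (A m s C : R) (c : R -> R) y : 0 < A -> 0 < s -> 0 < C ->
  C <= c y -> cresp A m s c y <= A * (gden s m y / C).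
Proof.
move=> A0 s0 C0 Cc; have N0 := gden_gt0 m y s0.
have AN : 0 < A * gden s m y by rewrite mulr_gt0.
have c0 : 0 < c y by exact: lt_le_trans Cc.
rewrite /cresp mulrA ler_pM2l// lef_pV2 ?posrE ?addr_gt0//.
by apply: le_trans Cc _; rewrite lerDr ltW.
Qed.

End Assembly.

(** * The case of two pairs *)

Section TwoPairs.
Context {R : realType}.

Lemma pair_index_cases k l : (1 <= k <= 2)%N -> (k + l = 3)%N ->
  k = 1%N /\ l = 2%N \/ k = 2%N /\ l = 1%N.
Proof.
by case: k l => [|[|[|k]]]// [|[|[|l]]]// _; [left|right].
Qed.

Lemma two_pairs_on_pair k l (a m1 m2 s1 s2 : R) :
  (1 <= k <= 2)%N -> (k + l = 3)%N ->
  2 / 5 <= a -> a <= 3 / 5 ->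
  k%:R <= m1 <= k%:R + 2 / 10 -> l%:R <= m2 <= l%:R + 2 / 10 ->
  9 / 100 <= s1 <= 21 / 200 -> 9 / 100 <= s2 <= 21 / 200 ->
  let c := other_weight 2 a m2 s2 in
  [/\ on_pair 2 k (2 * 2 * a) m1 s1 c, c k%:R <= 597 / 100 &
      c (k%:R + 2 / 10) <= 597 / 100].
Proof.
move=> hk kl a1 a2 /andP[km1 m1k] /andP[lm2 m2l] /andP[s11 s12] /andP[s21 s22] c.
have s10 : 0 < s1 by move: s11; clear; lra.
have s20 : 0 < s2 by move: s21; clear; lra.
have w0 : 0 < 1 - a by move: a2; clear; lra.
have c0 y : 0 < c y.
  by apply: mulr_gt0; [apply: mulr_gt0 => //; clear; lra|exact: gden_gt0].
have kl1 : (k%:R : R) + l%:R = 3 by rewrite -natrD kl.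
have dist : (k%:R : R) + 1 <= l%:R \/ (l%:R : R) + 1 <= k%:R.
  have [[-> ->]|[-> ->]] := pair_index_cases hk kl; [left|right]; clear; lra.
(* The competitor sits at least 8/10 away, so its density on this pair is far below the allowed
   597/100. *)
have c597 y : k%:R <= y -> y <= k%:R + 2 / 10 -> c y <= 597 / 100.
  move=> ky yk.
  have D0 : 0 <= (8 / 10) ^+ 2 :> R by exact: sqr_ge0.
  have D : (8 / 10) ^+ 2 <= (y - m2) ^+ 2.
    rewrite -subr_ge0 subr_sqr; case: dist => h.
      by rewrite -mulrNN; apply: mulr_ge0; move: h lm2 yk; clear; lra.
    by apply: mulr_ge0; move: h m2l ky; clear; lra.
  have := gden_upper s21 s22 D0 D.
  have e1 : expR (- (45 * (8 / 10) ^+ 2)) <= 1 / 20 :> R.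
    rewrite expRN -[leLHS]div1r ler_pdivrMr; last exact: expR_gt0.
    by have := expR_ge1Dx (45 * (8 / 10) ^+ 2 : R); clear; lra.
  have g0 := gden_gt0 m2 y s20; rewrite /c /other_weight => h.
  have h2 : gden s2 m2 y <= 100 / 9 * (1 / 20).
    by apply: le_trans h _; rewrite ler_wpM2l//; clear; lra.
  have := ler_pM (ltW w0) (ltW g0) (_ : 1 - a <= 3 / 5) h2.
  by move=> /(_ ltac:(move: a1; clear; lra)); clear; lra.
have x1 : c k%:R <= 597 / 100 by apply: c597 => //; clear; lra.
have x2 : c (k%:R + 2 / 10) <= 597 / 100 by apply: c597 => //; clear; lra.
split=> //; split=> //.
- by move: a1; clear; lra.
- by move: a2; clear; lra.
- apply: off_sum_leak; [by move: a1; clear; lra|by rewrite km1|].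
  move=> y yoff; set D := (y - m1) ^+ 2.
  have Dge : 64 / 100 <= D by apply: off_point_sqr_dist yoff _; rewrite km1.
  have yl : (y - m2) ^+ 2 <= (2 / 10) ^+ 2.
    have [yl1 yl2] : l%:R <= y /\ y <= l%:R + 2 / 10.
      have [j [/andP[j1 j2] jk yj]] := yoff.
      have jl : j = l.
        move: j1 j2 jk; have [[-> ->]|[-> ->]] := pair_index_cases hk kl;
          by case: j {yj} => [|[|[|]]].
      by rewrite -jl; case: yj => ->; clear; lra.
    by apply: sqr_le_dist; move: lm2 m2l yl1 yl2; clear; lra.
  have cy : 2 * 2 * (2 / 5) * (200 / 21 *
      expR (- ((2 / 10) ^+ 2 * (50 / 81 * 100)))) <= c y.
    have := gden_lower s21 s22 yl; rewrite /c /other_weight => h.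
    apply: ler_pM; [by clear; lra| |by move: a2; clear; lra|exact: h].
    by apply: mulr_ge0; [clear; lra|exact: expR_ge0].
  have C0 : 0 < 2 * 2 * (2 / 5) * (200 / 21 *
      expR (- ((2 / 10) ^+ 2 * (50 / 81 * 100)))) :> R.
    apply: mulr_gt0; first by clear; lra.
    by apply: mulr_gt0; [clear; lra|exact: expR_gt0].
  have A0 : 0 < 2 * 2 * a by move: a1; clear; lra.
  apply: le_trans (cresp_le m1 A0 s10 C0 cy) _.
  rewrite (mulrC 10) -[leRHS]mulrA (ler_pM2l A0) (ler_pdivrMr _ _ C0).
  have gu := gden_upper s11 s12 (sqr_ge0 _) (lexx D).
  apply: le_trans gu _.
  have -> : 10 * expR (- (20 * D)) * (2 * 2 * (2 / 5) *
    (200 / 21 * expR (- ((2 / 10) ^+ 2 * (50 / 81 * 100))))) =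
    (10 * (2 * 2 * (2 / 5)) * (200 / 21)) *
    (expR (- (20 * D)) * expR (- ((2 / 10) ^+ 2 * (50 / 81 * 100)))) by ring.
  rewrite -expRD; apply: ler_pM.
  + by clear; lra.
  + exact: expR_ge0.
  + by clear; lra.
  + by rewrite ler_expR -/D; move: Dge; clear; lra.
- by apply: le_trans x1 _; clear; lra.
- by apply: le_trans x2 _; clear; lra.
Qed.

Lemma two_pairs_critical (x : nat -> R) k l :
  (forall j, (1 <= j <= 2)%N ->
    x (2 * j - 1)%N = j%:R /\ x (2 * j)%N = j%:R + 2 / 10) ->
  (1 <= k <= 2)%N -> (k + l = 3)%N ->
  exists a m1 m2 s1 s2 : R,
    nontrivial_critical_point (loglik (2 * 2) x) (a, m1, m2, s1, s2) /\
    k%:R < m1 < k%:R + 2 / 10.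
Proof.
move=> hx hk kl.
have hl : (1 <= l <= 2)%N by have [[_ ->]|[_ ->]] := pair_index_cases hk kl.
apply: (exists_nontrivial (la := 2 / 5) (ha := 3 / 5)
  (lm2 := l%:R) (hm2 := l%:R + 2 / 10) (ls1 := 9 / 100) (hs1 := 21 / 200)
  (ls2 := 9 / 100) (hs2 := 21 / 200) hx); try by clear; lra.
move=> a m1 m2 s1 s2 r [/andP[a1 a2] b1 b2 d1 d2] Fa F1 F2 T1 T2.
have [d11 d12] := andP d1; have [d21 d22] := andP d2.
have s10 : 0 < s1 by move: d11; clear; lra.
have s20 : 0 < s2 by move: d21; clear; lra.
have a01 : 0 < a < 1 by move: a1 a2; clear; lra.
have lk : (l + k = 3)%N by rewrite addnC.
have [P c1 c2] := two_pairs_on_pair hk kl a1 a2 b1 b2 d1 d2.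
have a1' : 2 / 5 <= 1 - a by move: a2; clear; lra.
have a2' : 1 - a <= 3 / 5 by move: a1; clear; lra.
have [P' c1' c2'] := two_pairs_on_pair hl lk a1' a2' b2 b1 d2 d1.
set c := other_weight 2 a m2 s2 in P c1 c2.
set c' := other_weight 2 (1 - a) m1 s1 in P' c1' c2'.
set A := 2 * 2 * a in P; set A' := 2 * 2 * (1 - a) in P'.
have rE : r = cresp A m1 s1 c by apply/funext => y; exact: respE.
have rE' : (fun y => 1 - r y) = cresp A' m2 s2 c'.
  by apply/funext => y; rewrite /r -resp_swap//; exact: respE.
have sumA : pair_sum 2 (fun y => r y - a) = pair_sum 2 r - A.
  by rewrite pair_sumD pair_sum_cst mulrN.
have sumA' : pair_sum 2 (fun y => 1 - r y) = 2 * 2 - pair_sum 2 r.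
  rewrite (_ : pair_sum 2 _ = pair_sum 2 (fun y => 1 + -1 * r y)).
    by rewrite pair_sumD pair_sumZ pair_sum_cst mulN1r mulr1.
  by apply: pair_sum_ext => y; rewrite mulN1r.
have T := comp_total_le P; have T' := comp_total_le P'.
rewrite -rE in T; rewrite -rE' sumA' in T'.
rewrite sumA in Fa.
have alo : 2 / 5 < a.
  rewrite lt_neqAle a1 andbT; apply/eqP => e.
  have := Fa.2 ltac:(rewrite -e; clear; lra); move: T'.
  by rewrite /A' /A -e; move: (pair_sum _ _); clear => S; lra.
have ahi : a < 3 / 5.
  rewrite lt_neqAle a2 andbT; apply/eqP => e.
  have := Fa.1 ltac:(rewrite e; clear; lra); move: T.
  by rewrite /A e; move: (pair_sum _ _); clear => S; lra.
have total : pair_sum 2 r = A by apply/eqP; rewrite -subr_eq0 (face_cond_interior Fa).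
have total' : pair_sum 2 (fun y => 1 - r y) = A'.
  by rewrite sumA' total /A /A'; ring.
have F2' : face_cond l%:R (l%:R + 2 / 10) m2
    (pair_sum 2 (fun y => cresp A' m2 s2 c' y * (y - m2))) by rewrite -rE'.
have T2' : face_cond (9 / 100) (21 / 200) s2
    (pair_sum 2 (fun y => cresp A' m2 s2 c' y * ((y - m2) ^+ 2 - s2 ^+ 2))).
  by rewrite -rE'.
rewrite rE in F1 T1 total; rewrite rE' in total'.
have [n1 n2] := comp_mean_interior P F1.
have [n1' n2'] := comp_mean_interior P' F2'.
have mean := face_cond_interior F1 n1 n2.
have mean' := face_cond_interior F2' n1' n2'.
split.
  rewrite alo ahi n1 n2 n1' n2'; split=> //.
    rewrite (comp_sd_lt P total mean T1.1) andbT.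
    by apply: (comp_sd_gt P total mean _ _ T1.2); left.
  rewrite (comp_sd_lt P' total' mean' T2'.1) andbT.
  by apply: (comp_sd_gt P' total' mean' _ _ T2'.2); left.
case=> em _; move: n1 n2 n1' n2'; rewrite em.
have [klt|llt|e] := ltngtP k l;
  last by move: kl; rewrite e => /(congr1 odd); rewrite addnn odd_double.
  have : k.+1%:R <= l%:R :> R by rewrite ler_nat.
  by rewrite -natr1; clear; lra.
have : l.+1%:R <= k%:R :> R by rewrite ler_nat.
by rewrite -natr1; clear; lra.
Qed.

End TwoPairs.

(** * The case of at least three pairs *)

Section ManyPairs.
Context {R : realType}.
Implicit Types (K k : nat).

Lemma pair_sum_sqr K (z : R) : let m := z - 1 / 10 in let n : R := K%:R in
  pair_sum K (fun y => (y - z) ^+ 2) =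
  2 * (n * (n ^+ 2 - 1) / 12 + n * (m - (n + 1) / 2) ^+ 2) + n / 50.
Proof.
elim: K => [|K IH] /=; first by rewrite /pair_sum big_geq// !mul0r; ring.
rewrite /pair_sum big_nat_recr//= -/(pair_sum K (fun y => (y - z) ^+ 2)) IH/=.
by rewrite -natr1; field.
Qed.

Lemma pair_sum_sqr_ge K (z : R) :
  2 * K%:R * ((K%:R ^+ 2 - 1) / 12 + 1 / 100)
  <= pair_sum K (fun y => (y - z) ^+ 2).
Proof.
rewrite pair_sum_sqr; have n0 : 0 <= K%:R :> R by exact: ler0n.
have := mulr_ge0 n0 (sqr_ge0 (z - 1 / 10 - (K%:R + 1) / 2)).
by move: (_ ^+ 2) => q; clear; lra.
Qed.

Lemma off_sum_sqr_ge K k (z : R) : (2 <= K)%N -> (1 <= k <= K)%N ->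
  K%:R * (K%:R - 1) * (K%:R - 2) / 6 <= off_sum K k (fun y => (y - z) ^+ 2).
Proof.
move=> K2 hk; have K2R : 2 <= K%:R :> R by rewrite (ler_nat _ 2).
have [k1 kK] := andP hk.
have k1R : 1 <= k%:R :> R by rewrite ler1n.
have kKR : k%:R <= K%:R :> R by rewrite ler_nat.
have := pair_sum_sqr K z; rewrite (pair_sumD1 _ hk)/=.
move: (off_sum _ _ _) => o; move: K2R k1R kKR; clear.
move: (K%:R : R) (k%:R : R) => n i n2 i1 i2 e.
pose Y := z - 1 / 10 - (n + 1) / 2; pose Z := i - (n + 1) / 2.
have oE : o = n * (n ^+ 2 - 1) / 6 + 2 * (n * Y ^+ 2 - (Y - Z) ^+ 2) + (n - 1) / 50.
  by rewrite /Y /Z; move: e; clear; lra.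
have n1 : 0 < n - 1 by move: n2; clear; lra.
have Z2 : Z ^+ 2 <= ((n - 1) / 2) ^+ 2.
  by apply: sqr_le_dist; rewrite /Z; move: i1 i2; clear; lra.
have h : - (n * (n - 1) / 4) <= n * Y ^+ 2 - (Y - Z) ^+ 2.
  rewrite -(ler_pM2l n1).
  have -> : (n - 1) * (n * Y ^+ 2 - (Y - Z) ^+ 2) =
    ((n - 1) * Y + Z) ^+ 2 - n * Z ^+ 2 by ring.
  have n0 : 0 <= n by move: n2; clear; lra.
  have := ler_wpM2l n0 Z2; have := sqr_ge0 ((n - 1) * Y + Z).
  by move: (_ ^+ 2) (Z ^+ 2) => p q; clear; lra.
rewrite oE; move: h n2; move: (n * Y ^+ 2 - _) => q; clear; lra.
Qed.

Lemma pair_weight_bound (n A V v w : R) :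
  6 <= n -> 0 < A -> A <= 5 / 2 -> n ^+ 2 <= (73 / 10) ^+ 2 * V ->
  n * V <= n * v + A * (3 / 2 * w + 1 / 8) -> 2 / 13 <= v -> 0 <= w ->
  (n - A) ^+ 2 <= (73 / 10) ^+ 2 * (v + w) /\
  (v / 2 <= w -> (n - A) ^+ 2 <= (73 / 10) ^+ 2 * (2 / 3 * (v + w))).
Proof.
move=> n6 A0 A25 nV nVv v13 w0.
have n0 : 0 < n by move: n6; clear; lra.
have v0 : 0 < v by move: v13; clear; lra.
have An : A <= n by move: n6 A25; clear; lra.
have nA0 := sqr_ge0 (n - A).
have n30 : 0 < n ^+ 3 by rewrite exprn_gt0.
set C := (73 / 10) ^+ 2 in nV *.
have C0 : 0 < C by rewrite /C; clear; lra.
have n3 : n ^+ 3 <= C * (n * v + 3 / 2 * A * w + 13 / 16 * A * v).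
  have h1 := ler_wpM2l (ltW n0) nV.
  have h2 := ler_wpM2l (ltW C0) nVv.
  have h3 : C * (A * (1 / 8)) <= C * (13 / 16 * A * v).
    rewrite ler_pM2l//.
    by have := ler_wpM2l (ltW A0) v13; clear; lra.
  by move: h1 h2 h3; clear; move: C => C; lra.
have sqA : (n - A) ^+ 2 <= n ^+ 2.
  by apply: sqr_le_dist; move: A0 An; clear; lra.
have An2 : 0 <= (n - A) * (n * A) by rewrite !mulr_ge0 ?subr_ge0// ltW.
have AA2 : 0 <= (n - A) * A ^+ 2 by rewrite !mulr_ge0 ?subr_ge0 ?sqr_ge0// ltW.
have nAA : 0 <= n * A * A by rewrite !mulr_ge0// ltW.
have red (X : R) : (n - A) ^+ 2 * (n * v + 3 / 2 * A * w + 13 / 16 * A * v)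
    <= n ^+ 3 * X -> (n - A) ^+ 2 <= C * X.
  move=> h; rewrite -(ler_pM2l n30).
  have := ler_wpM2l nA0 n3; have := ler_wpM2l (ltW C0) h.
  by clear; move: C => C; lra.
have cube (b : R) : 0 <= b -> b <= 2 -> (n - A) ^+ 2 * (n + b * A) <= n ^+ 3.
  move=> b0 b2; rewrite -subr_ge0.
  have -> : n ^+ 3 - (n - A) ^+ 2 * (n + b * A) =
    (2 - b) * (n * (n * A) - n * A * A) + n * A * A
    + b * ((n - A) * A ^+ 2) by ring.
  have q1 : 0 <= (2 - b) * (n * (n * A) - n * A * A).
    by apply: mulr_ge0; [rewrite subr_ge0|move: An2; clear; lra].
  have q3 : 0 <= b * ((n - A) * A ^+ 2) by rewrite mulr_ge0.
  by rewrite !addr_ge0.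
have lin (d : R) : 3 / 2 * A <= d * n -> (n - A) ^+ 2 * (3 / 2 * A) <= d * n ^+ 3.
  move=> h; have -> : d * n ^+ 3 = n ^+ 2 * (d * n) by ring.
  by apply: ler_pM => //; rewrite mulr_ge0 ?ltW.
split=> [|vw]; apply: red.
  have h1 := ler_wpM2r (ltW v0) (cube (13 / 16) ltac:(lra) ltac:(lra)).
  have h2 := ler_wpM2r w0 (lin 1 ltac:(move: n6 A25; clear; lra)).
  by move: h1 h2; clear; lra.
have z0 : 0 <= w - v / 2 by rewrite subr_ge0.
have h1 := ler_wpM2r (ltW v0) (cube (25 / 16) ltac:(lra) ltac:(lra)).
have h2 := ler_wpM2r z0 (lin (2 / 3) ltac:(move: n6 A25; clear; lra)).
by move: h1 h2; clear; lra.
Qed.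

End ManyPairs.

Section ManyPairsBounds.
Context {R : realType}.
Implicit Types (K k : nat).

Lemma pair_sum_le K (F G : R -> R) :
  (forall j y, (1 <= j <= K)%N -> y = j%:R \/ y = j%:R + 2 / 10 ->
    F y <= G y) -> pair_sum K F <= pair_sum K G.
Proof.
move=> FG; rewrite /pair_sum big_nat_cond [leRHS]big_nat_cond.
apply: ler_sum => j /andP[jK _].
by apply: lerD; apply: (FG j) => //; [left|right].
Qed.

Lemma sample_range K j (y : R) : (1 <= j <= K)%N ->
  y = j%:R \/ y = j%:R + 2 / 10 -> 1 <= y /\ y <= K%:R + 2 / 10.
Proof.
move=> /andP[j1 jK] yj; have j1R : 1 <= j%:R :> R by rewrite ler1n.
have jKR : j%:R <= K%:R :> R by rewrite ler_nat.
by case: yj => ->; move: j1R jKR; clear; split; lra.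
Qed.

Lemma off_point_range K k (y : R) : off_point K k y ->
  1 <= y /\ y <= K%:R + 2 / 10.
Proof. by move=> [j [jK _ yj]]; exact: sample_range yj. Qed.

Lemma many_pairs_leak K k (a m1 m2 s1 s2 y : R) : (3 <= K)%N ->
  0 < a -> 2 * K%:R * a <= 5 / 2 ->
  k%:R <= m1 <= k%:R + 2 / 10 -> 1 <= m2 <= K%:R + 2 / 10 ->
  9 / 100 <= s1 <= 21 / 200 ->
  0 < s2 -> s2 <= K%:R -> (K%:R - 1) * (K%:R - 2) / 13 <= s2 ^+ 2 ->
  off_point K k y ->
  cresp (2 * K%:R * a) m1 s1 (other_weight K a m2 s2) y <=
  10 * (2 * K%:R * a) * expR (- (20 * (y - m1) ^+ 2)).
Proof.
move=> K3 a0 A25 m1k /andP[m21 m2K] /andP[s11 s12] s20 s2K s2v yoff.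
have K3R : 3 <= K%:R :> R by rewrite (ler_nat _ 3).
have s10 : 0 < s1 by move: s11; clear; lra.
set D := (y - m1) ^+ 2.
have Dge : 64 / 100 <= D by exact: off_point_sqr_dist yoff m1k.
have K0 : 0 < K%:R :> R by move: K3R; clear; lra.
have A0 : 0 < 2 * K%:R * a by rewrite !mulr_gt0.
have q : (y - m2) ^+ 2 / (2 * s2 ^+ 2) <= 63 / 4.
  rewrite ler_pdivrMr; last by rewrite mulr_gt0 ?exprn_gt0.
  have [y1 yK] := off_point_range yoff.
  have h : (y - m2) ^+ 2 <= (K%:R - 8 / 10) ^+ 2.
    by apply: sqr_le_dist; move: y1 yK m21 m2K; clear; lra.
  have h2 : (K%:R - 8 / 10) ^+ 2 <= 242 / 100 * ((K%:R - 1) * (K%:R - 2)) :> R.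
    have K30 : 0 <= K%:R - 3 :> R by rewrite subr_ge0.
    by have := mulr_ge0 K30 K30; move: K3R; clear; move: (K%:R) => n; lra.
  apply: (le_trans h); apply: (le_trans h2).
  by move: s2v (sqr_ge0 s2); clear; lra.
have cy : 7 / 6 * expR (- (63 / 4)) <= other_weight K a m2 s2 y.
  rewrite /other_weight /gden mulrA; apply: ler_pM.
  - by clear; lra.
  - exact: expR_ge0.
  - rewrite ler_pdivlMr//.
    by move: s2K A25 K3R; clear; move: (K%:R) => n; lra.
  - by rewrite ler_expR lerN2.
have C0 : 0 < 7 / 6 * expR (- (63 / 4)) :> R.
  by apply: mulr_gt0; [clear; lra|exact: expR_gt0].
apply: le_trans (cresp_le m1 A0 s10 C0 cy) _.
rewrite (mulrC 10) -[leRHS]mulrA (ler_pM2l A0) (ler_pdivrMr _ _ C0).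
have gu := gden_upper s11 s12 (sqr_ge0 _) (lexx D).
apply: le_trans gu _.
have -> : 10 * expR (- (20 * D)) * (7 / 6 * expR (- (63 / 4))) =
  (10 * (7 / 6)) * (expR (- (20 * D)) * expR (- (63 / 4))) by ring.
rewrite -expRD; apply: ler_pM.
- by clear; lra.
- exact: expR_ge0.
- by clear; lra.
- by rewrite ler_expR -/D; move: Dge; clear; lra.
Qed.

(* The left-hand side is 2K times the sample variance: apart from the points
   explained by the narrow component near x0, the broad one accounts for it. *)
Lemma broad_variance K k (A m1 m2 v x0 : R) (r : R -> R) :
  (1 <= k <= K)%N -> k%:R <= m1 <= k%:R + 2 / 10 ->
  x0 = k%:R \/ x0 = k%:R + 2 / 10 ->
  0 <= v -> (forall y, 0 <= r y) -> pair_sum K r <= A ->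
  off_sum K k (fun y => r y * (y - m1) ^+ 2) <= A / 2000 ->
  pair_sum K (fun y => (1 - r y) * ((y - m2) ^+ 2 - v)) <= 0 ->
  2 * K%:R * ((K%:R ^+ 2 - 1) / 12 + 1 / 100) <=
  2 * K%:R * v + A * (3 / 2 * (x0 - m2) ^+ 2 + 1 / 8).
Proof.
move=> hk m1k x0E v0 r0 rA leak F.
have S := pair_sum_sqr_ge K m2.
have off0 : 0 <= off_sum K k r by apply: off_sum_ge0.
have rD := pair_sumD1 r hk.
have b0 : pair_sum K (fun y => r y * (y - x0) ^+ 2) <=
    (2 / 10) ^+ 2 * A + 17 / 8 * (A / 2000).
  rewrite (pair_sumD1 _ hk); apply: lerD.
    case: x0E => ->; rewrite subrr expr0n mulr0 ?add0r ?addr0.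
      rewrite (_ : k%:R + 2 / 10 - k%:R = 2 / 10); last by ring.
      move: rD rA off0 (r0 k%:R); clear.
      by move: (pair_sum _ _) (off_sum _ _ _) (r _) (r _) => s o p q; lra.
    rewrite (_ : k%:R - (k%:R + 2 / 10) = - (2 / 10)); last by ring.
    move: rD rA off0 (r0 (k%:R + 2 / 10)); clear; rewrite sqrrN.
    by move: (pair_sum _ _) (off_sum _ _ _) (r _) (r _) => s o p q; lra.
  apply: (@le_trans _ _ (17 / 8 * off_sum K k (fun y => r y * (y - m1) ^+ 2))).
    rewrite -off_sumZ; apply: off_sum_le => y yoff.
    rewrite [leRHS]mulrCA ler_wpM2l//.
    have d := off_point_sqr_dist yoff m1k.
    have x0m : (m1 - x0) ^+ 2 <= (2 / 10) ^+ 2.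
      by apply: sqr_le_dist; move: x0E m1k; clear=> -[->|->] /andP[]; lra.
    move: d x0m (sqr_ge0 ((y - m1) - (m1 - x0))); clear => d x0m.
    have -> : (y - x0) ^+ 2 = 2 * (y - m1) ^+ 2 + 2 * (m1 - x0) ^+ 2 -
      ((y - m1) - (m1 - x0)) ^+ 2 by ring.
    move: d x0m; move: ((y - m1) ^+ 2) ((m1 - x0) ^+ 2) ((_ - _) ^+ 2) => p q s.
    by lra.
  by rewrite ler_pM2l//; clear; lra.
have b : pair_sum K (fun y => r y * (y - m2) ^+ 2) <=
    3 / 2 * (x0 - m2) ^+ 2 * A + 3 * ((2 / 10) ^+ 2 * A + 17 / 8 * (A / 2000)).
  apply: (@le_trans _ _ (pair_sum K (fun y => 3 / 2 * (x0 - m2) ^+ 2 * r y +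
      3 * (r y * (y - x0) ^+ 2)))).
    apply: pair_sum_le => j y _ _.
    have := mulr_ge0 (r0 y) (sqr_ge0 ((x0 - m2) / 2 - (y - x0))).
    have -> : (y - m2) = (x0 - m2) + (y - x0) by ring.
    by move: (r y) (x0 - m2) (y - x0) => p q s; clear; lra.
  rewrite pair_sumD !pair_sumZ; apply: lerD.
    by rewrite ler_wpM2l// mulr_ge0 ?sqr_ge0//; clear; lra.
  by rewrite ler_pM2l//; clear; lra.
have r1 : 0 <= pair_sum K r.
  by rewrite rD !addr_ge0.
have e : pair_sum K (fun y => (1 - r y) * ((y - m2) ^+ 2 - v)) =
    pair_sum K (fun y => (y - m2) ^+ 2) - pair_sum K (fun y => r y * (y - m2) ^+ 2)
    + (v * pair_sum K r - 2 * K%:R * v).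
  rewrite (_ : pair_sum K _ = pair_sum K (fun y => (y - m2) ^+ 2 +
    (-1 * (r y * (y - m2) ^+ 2) + (v * r y + - v)))).
    by rewrite !pair_sumD !pair_sumZ pair_sum_cst; ring.
  by apply: pair_sum_ext => y; ring.
rewrite e in F; have := mulr_ge0 v0 r1.
have A0 := le_trans r1 rA.
move: F S b A0; clear; move: (v * _) => vr.
move: (pair_sum _ _) (pair_sum _ _) => s1 s2.
by move: ((x0 - m2) ^+ 2) (2 * K%:R) => w n; lra.
Qed.

Lemma other_weight_le K (a m s y B : R) : 0 < a -> a < 1 -> 0 < s -> 0 <= B ->
  (2 * K%:R * (1 - a)) ^+ 2 <= B ^+ 2 * (s ^+ 2 + (y - m) ^+ 2) ->
  other_weight K a m s y <= B.
Proof.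
move=> a0 a1 s0 B0 h; have s20 : 0 < s ^+ 2 by rewrite exprn_gt0.
have g0 := gden_gt0 m y s0.
have w0 : 0 <= other_weight K a m s y.
  apply: mulr_ge0; last exact: ltW.
  by apply: mulr_ge0; [rewrite mulr_ge0|rewrite subr_ge0 ltW].
rewrite -(ler_pXn2r (_ : (0 < 2)%N)) ?nnegrE//.
have gE : gden s m y ^+ 2 = (s ^+ 2 * expR ((y - m) ^+ 2 / s ^+ 2))^-1.
  rewrite /gden exprMn -expRM_natl.
  rewrite (_ : 2 * _ = - ((y - m) ^+ 2 / s ^+ 2)); last by field; rewrite gt_eqF.
  by rewrite expRN exprVn -invfM.
rewrite /other_weight exprMn gE ler_pdivrMr; last by rewrite mulr_gt0// expR_gt0.
apply: (le_trans h); rewrite ler_wpM2l ?sqr_ge0//.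
apply: (@le_trans _ _ (s ^+ 2 * (1 + (y - m) ^+ 2 / s ^+ 2))).
  by rewrite mulrDr mulr1 mulrCA divff ?mulr1// gt_eqF.
by rewrite ler_wpM2l ?expR_ge1Dx// ltW.
Qed.

Lemma other_weight_ratio K (a m s y z : R) : 0 < a -> a < 1 -> 0 < s ->
  2 / 13 <= s ^+ 2 -> (y - m) ^+ 2 <= s ^+ 2 / 2 ->
  (z - y) ^+ 2 <= (2 / 10) ^+ 2 ->
  other_weight K a m s y * expR (- (1 / 2)) <= other_weight K a m s z.
Proof.
move=> a0 a1 s0 v13 w2 zy; rewrite /other_weight /gden.
have : 0 <= 2 * K%:R * (1 - a) by rewrite !mulr_ge0// subr_ge0 ltW.
move: (2 * K%:R * (1 - a)) => w w0.
rewrite -!mulrA -expRD; apply: ler_wpM2l => //.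
rewrite ler_pM2l ?invr_gt0// ler_expR.
have v0 : 0 < s ^+ 2 by rewrite exprn_gt0.
suff : ((z - m) ^+ 2 - (y - m) ^+ 2) / (2 * s ^+ 2) <= 1 / 2.
  by rewrite mulrBl; clear; lra.
rewrite ler_pdivrMr ?mulr_gt0//.
have -> : (z - m) ^+ 2 - (y - m) ^+ 2 = 2 * (z - y) * (y - m) + (z - y) ^+ 2 by ring.
have h : 2 * (z - y) * (y - m) <= s ^+ 2 - (2 / 10) ^+ 2.
  have d0 : 0 <= s ^+ 2 - (2 / 10) ^+ 2 by move: v13; clear; lra.
  apply: le_trans (ler_norm _) _; rewrite -(ler_pXn2r (_ : (0 < 2)%N)) ?nnegrE//.
  rewrite real_normK ?num_real// !exprMn.
  apply: (@le_trans _ _ (2 ^+ 2 * (2 / 10) ^+ 2 * (s ^+ 2 / 2))).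
    apply: ler_pM => //; first by rewrite mulr_ge0 ?sqr_ge0.
      exact: sqr_ge0.
    by move: zy; clear; move: ((z - y) ^+ 2) => q; lra.
  have v1 : 0 <= s ^+ 2 - 2 / 13 by rewrite subr_ge0.
  by have := mulr_ge0 v1 v1; move: v1; clear; move: (s ^+ 2) => v; lra.
by move: h zy; clear; lra.
Qed.

Lemma small_weight_gain (A s m x1 c1 c2 : R) :
  A = 1 / 100 -> 9 / 100 <= s -> s <= 21 / 200 ->
  x1 <= m -> m <= x1 + 2 / 10 -> 0 < c1 -> c1 <= 73 / 10 ->
  0 < c2 -> c2 <= 73 / 10 ->
  A < A * gden s m x1 / (A * gden s m x1 + c1) +
      A * gden s m (x1 + 2 / 10) / (A * gden s m (x1 + 2 / 10) + c2).
Proof.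
move=> -> s1 s2 m1 m2 c10 c1le c20 c2le.
have s0 : 0 < s by move: s1; clear; lra.
have A0 : 0 < 1 / 100 :> R by clear; lra.
have frac (n0 b y c : R) : 0 <= n0 -> 0 < c -> c <= 73 / 10 ->
    n0 <= gden s m y -> b * (n0 / 100 + 73 / 10) <= n0 -> 0 <= b -> b <= 100 ->
    b / 100 <= 1 / 100 * gden s m y / (1 / 100 * gden s m y + c).
  move=> n00 c0 c7 n0g h b0 b100; have g0 := gden_gt0 m y s0.
  rewrite ler_pdivlMr; last by rewrite addr_gt0// mulr_gt0.
  have h1 := ler_wpM2l b0 c7.
  have b1 : 0 <= 100 - b by rewrite subr_ge0.
  have h2 := ler_wpM2l b1 n0g.
  by move: h h1 h2; move: (gden s m y) => g; clear; lra.
have pos (y c : R) :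
    0 < c -> 0 < 1 / 100 * gden s m y / (1 / 100 * gden s m y + c).
  by move=> c0; have g0 := gden_gt0 m y s0; rewrite divr_gt0 ?addr_gt0// mulr_gt0.
have near y d : d = 11 / 200 -> - d <= y - m -> y - m <= d -> 77 / 10 <= gden s m y.
  move=> -> d1 d2; apply: le_trans (gden_lower s1 s2 (sqr_le_dist d1 d2)).
  have := expR_ge1Dx (- ((11 / 200) ^+ 2 * (50 / 81 * 100)) : R).
  by clear; move: (expR _) => e; lra.
have mid y d : d = 1 / 10 -> - d <= y - m -> y - m <= d -> 5 <= gden s m y.
  move=> -> d1 d2; apply: le_trans (gden_lower s1 s2 (sqr_le_dist d1 d2)).
  have : 53 / 100 <= expR (- ((1 / 10) ^+ 2 * (50 / 81 * 100))) :> R.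
    by clear; apply: le_trans (@expR_ge_pow R 15 _ _); lra.
  by clear; move: (expR _) => e; lra.
have far y d : d = 29 / 200 -> - d <= y - m -> y - m <= d -> 5 / 2 <= gden s m y.
  move=> -> d1 d2; apply: le_trans (gden_lower s1 s2 (sqr_le_dist d1 d2)).
  have : 265 / 1000 <= expR (- ((29 / 200) ^+ 2 * (50 / 81 * 100))) :> R.
    by clear; apply: le_trans (@expR_ge_pow R 31 _ _); lra.
  by clear; move: (expR _) => e; lra.
set x2 := x1 + 2 / 10.
have p1 := pos x1 c1 c10; have p2 := pos x2 c2 c20.
have [l1|l1] := leP m (x1 + 11 / 200).
  have n1 : 77 / 10 <= gden s m x1.
    by apply: near erefl _ _; move: l1 m1; clear; lra.
  have := frac (77 / 10) (104 / 100) _ _ ltac:(clear; lra) c10 c1le n1.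
  move=> /(_ ltac:(clear; lra) ltac:(clear; lra) ltac:(clear; lra)).
  by move: p2; move: (_ / (_ + c1)) (_ / (_ + c2)) => p q; clear; lra.
have [l2|l2] := leP (x1 + 29 / 200) m.
  have n2 : 77 / 10 <= gden s m x2.
    by apply: near erefl _ _; rewrite /x2; move: l2 m2; clear; lra.
  have := frac (77 / 10) (104 / 100) _ _ ltac:(clear; lra) c20 c2le n2.
  move=> /(_ ltac:(clear; lra) ltac:(clear; lra) ltac:(clear; lra)).
  by move: p1; move: (_ / (_ + c1)) (_ / (_ + c2)) => p q; clear; lra.
have [l3|l3] := leP m (x1 + 1 / 10).
  have n1 : 5 <= gden s m x1 by apply: mid erefl _ _; move: l3 m1; clear; lra.
  have n2 : 5 / 2 <= gden s m x2.
    by apply: far erefl _ _; rewrite /x2; move: l1 m2; clear; lra.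
  have := frac 5 (68 / 100) _ _ ltac:(clear; lra) c10 c1le n1.
  move=> /(_ ltac:(clear; lra) ltac:(clear; lra) ltac:(clear; lra)).
  have := frac (5 / 2) (34 / 100) _ _ ltac:(clear; lra) c20 c2le n2.
  move=> /(_ ltac:(clear; lra) ltac:(clear; lra) ltac:(clear; lra)).
  by move: (_ / (_ + c1)) (_ / (_ + c2)) => p q; clear; lra.
have n1 : 5 / 2 <= gden s m x1 by apply: far erefl _ _; move: l2 m1; clear; lra.
have n2 : 5 <= gden s m x2.
  by apply: mid erefl _ _; rewrite /x2; move: l3 m2; clear; lra.
have := frac (5 / 2) (34 / 100) _ _ ltac:(clear; lra) c10 c1le n1.
move=> /(_ ltac:(clear; lra) ltac:(clear; lra) ltac:(clear; lra)).
have := frac 5 (68 / 100) _ _ ltac:(clear; lra) c20 c2le n2.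
move=> /(_ ltac:(clear; lra) ltac:(clear; lra) ltac:(clear; lra)).
by move: (_ / (_ + c1)) (_ / (_ + c2)) => p q; clear; lra.
Qed.

End ManyPairsBounds.

Section ManyPairsCritical.
Context {R : realType}.
Implicit Types (K k : nat).

Lemma broad_mean_interior K (m : R) (q : R -> R) : (2 <= K)%N ->
  1 <= m <= K%:R + 2 / 10 -> (forall y, 0 < q y) ->
  face_cond 1 (K%:R + 2 / 10) m (pair_sum K (fun y => q y * (y - m))) ->
  1 < m < K%:R + 2 / 10.
Proof.
move=> K2 /andP[m1 m2] q0 [F1 F2].
have K2R : 2 <= K%:R :> R by rewrite (ler_nat _ 2).
have K0 : (0 < K)%N by exact: leq_trans K2.
apply/andP; split; rewrite lt_neqAle ?m1 ?m2 andbT; apply/eqP => e.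
  have := F2 ltac:(rewrite -e; move: K2R; clear; lra).
  rewrite (pair_sumD1 (k := 1%N))// -e.
  have : 0 <= off_sum K 1 (fun y => q y * (y - 1)).
    apply: off_sum_ge0 => y yoff; have [y1 _] := off_point_range yoff.
    by rewrite mulr_ge0 ?subr_ge0// ltW.
  have := q0 (1 + 2 / 10).
  by move: (off_sum _ _ _) (q _) (q _) => o p p'; clear; lra.
have := F1 ltac:(rewrite e; move: K2R; clear; lra).
rewrite (pair_sumD1 (k := K)) ?K0 ?leqnn// e.
have : 0 <= off_sum K K (fun y => q y * (K%:R + 2 / 10 - y)).
  apply: off_sum_ge0 => y yoff; have [_ yK] := off_point_range yoff.
  by rewrite mulr_ge0 ?subr_ge0// ltW.
rewrite (_ : off_sum K K (fun y => q y * (K%:R + 2 / 10 - y)) =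
  -1 * off_sum K K (fun y => q y * (y - (K%:R + 2 / 10)))).
  have := q0 K%:R; rewrite subrr mulr0 addr0.
  rewrite (_ : K%:R - (K%:R + 2 / 10) = - (2 / 10)); last by ring.
  by move: (off_sum _ _ _) (q _) => o p; clear; lra.
by rewrite -off_sumZ; apply: eq_bigr => j _; ring.
Qed.

Lemma broad_sd_lt K (m s : R) (q : R -> R) : (2 <= K)%N ->
  1 <= m <= K%:R + 2 / 10 -> s <= K%:R -> (forall y, 0 < q y) ->
  (s = K%:R -> 0 <= pair_sum K (fun y => q y * ((y - m) ^+ 2 - s ^+ 2))) ->
  s < K%:R.
Proof.
move=> K2 /andP[m1 m2] sK q0 F.
have K2R : 2 <= K%:R :> R by rewrite (ler_nat _ 2).
have K0 : (0 < K)%N by exact: leq_trans K2.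
rewrite lt_neqAle sK andbT; apply/eqP => e.
have := F e; rewrite e; apply/negP; rewrite -ltNge.
have neg y : 1 <= y -> y <= K%:R + 2 / 10 -> q y * ((y - m) ^+ 2 - K%:R ^+ 2) < 0.
  move=> y1 yK; rewrite pmulr_rlt0// subr_lt0.
  apply: (@le_lt_trans _ _ ((K%:R - 8 / 10) ^+ 2)).
    by apply: sqr_le_dist; move: m1 m2 y1 yK; clear; lra.
  by move: K2R; clear; move: (K%:R) => n; lra.
have n1 := neg 1 (lexx _) ltac:(move: K2R; clear; lra).
have n2 := neg (1 + 2 / 10) ltac:(clear; lra) ltac:(move: K2R; clear; lra).
rewrite (pair_sumD1 (k := 1%N))//.
have : 0 <= off_sum K 1 (fun y => -1 * (q y * ((y - m) ^+ 2 - K%:R ^+ 2))).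
  apply: off_sum_ge0 => y /off_point_range[y1 yK].
  by rewrite mulN1r oppr_ge0 ltW// neg.
rewrite off_sumZ; move: n1 n2.
by move: (off_sum _ _ _) (q _ * _) (q _ * _) => o p p'; clear; lra.
Qed.

Lemma broad_sd_gt K k (A m1 m2 v : R) (r : R -> R) : (3 <= K)%N ->
  (1 <= k <= K)%N -> k%:R <= m1 <= k%:R + 2 / 10 ->
  1 <= m2 <= K%:R + 2 / 10 -> A <= 5 / 2 ->
  (forall y, 0 < r y) -> (forall y, r y < 1) ->
  off_sum K k (fun y => r y * (y - m1) ^+ 2) <= A / 2000 ->
  pair_sum K (fun y => (1 - r y) * ((y - m2) ^+ 2 - v)) <= 0 ->
  0 <= v -> (K%:R - 1) * (K%:R - 2) / 13 < v.
Proof.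
move=> K3 hk m1k /andP[m21 m22] A25 r0 r1 leak F v0.
have K3R : 3 <= K%:R :> R by rewrite (ler_nat _ 3).
have S := off_sum_sqr_ge m2 (ltnW K3) hk.
have b : off_sum K k (fun y => r y * (y - m2) ^+ 2) <=
    K%:R ^+ 2 * (25 / 16) * (A / 2000).
  apply: (@le_trans _ _ (K%:R ^+ 2 * (25 / 16) *
      off_sum K k (fun y => r y * (y - m1) ^+ 2))); last first.
    by rewrite ler_wpM2l// mulr_ge0 ?sqr_ge0//; clear; lra.
  rewrite -off_sumZ; apply: off_sum_le => y yoff.
  rewrite [leRHS]mulrCA ler_wpM2l ?(ltW (r0 _))//.
  have d := off_point_sqr_dist yoff m1k; have [y1 yK] := off_point_range yoff.
  apply: (@le_trans _ _ (K%:R ^+ 2)).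
    by apply: sqr_le_dist; move: m21 m22 y1 yK; clear; lra.
  by rewrite -mulrA ler_peMr ?sqr_ge0//; move: d; clear; lra.
have e : off_sum K k (fun y => (y - m2) ^+ 2) -
    off_sum K k (fun y => r y * (y - m2) ^+ 2) - 2 * K%:R * v <=
    pair_sum K (fun y => (1 - r y) * ((y - m2) ^+ 2 - v)).
  have -> : pair_sum K (fun y => (1 - r y) * ((y - m2) ^+ 2 - v)) =
      pair_sum K (fun y => (1 - r y) * (y - m2) ^+ 2 + v * r y) - 2 * K%:R * v.
    rewrite -mulrN -(pair_sum_cst K (- v)) -pair_sumD.
    by apply: pair_sum_ext => y; ring.
  rewrite lerD2r (pair_sumD1 _ hk).
  have pos y : 0 <= (1 - r y) * (y - m2) ^+ 2 + v * r y.
    apply: addr_ge0; apply: mulr_ge0; rewrite ?sqr_ge0 ?subr_ge0// ltW//.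
  apply: (@le_trans _ _ (off_sum K k (fun y =>
      (1 - r y) * (y - m2) ^+ 2 + v * r y))); last first.
    by rewrite lerDr addr_ge0.
  rewrite lerBlDr -off_sumD; apply: off_sum_le => y _.
  have := mulr_ge0 v0 (ltW (r0 y)).
  by move: (r y) (y - m2) => p q; clear; lra.
move: F S b e K3R A25; clear.
move: (pair_sum _ _) (off_sum _ _ _) (off_sum _ _ _) => p o1 o2.
move: (K%:R) => n F S b e n3 A25.
have n0 : 0 < n by move: n3; clear; lra.
have main : n * ((n - 1) * (n - 2) / 6) - n * (n * (25 / 16) * (A / 2000))
    <= n * (2 * v).
  by move: F S b e; clear; lra.
have {}main : (n - 1) * (n - 2) / 6 - n * (25 / 16) * (A / 2000) <= 2 * v.
  by rewrite -(ler_pM2l n0) mulrBr.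
have nA : n * A <= n * (5 / 2) by rewrite ler_pM2l.
have n30 : 0 <= n - 3 by rewrite subr_ge0.
have := mulr_ge0 n30 n30.
by move: main nA n3; clear; lra.
Qed.

Lemma many_pairs_critical K k (x : nat -> R) : (3 <= K)%N -> (1 <= k <= K)%N ->
  (forall j, (1 <= j <= K)%N ->
    x (2 * j - 1)%N = j%:R /\ x (2 * j)%N = j%:R + 2 / 10) ->
  exists a m1 m2 s1 s2 : R,
    nontrivial_critical_point (loglik (2 * K) x) (a, m1, m2, s1, s2) /\
    k%:R < m1 < k%:R + 2 / 10.
Proof.
move=> K3 hk hx.
have K3R : 3 <= K%:R :> R by rewrite (ler_nat _ 3).
have K0 : (0 < K)%N by exact: leq_trans K3.
have n6 : 6 <= 2 * K%:R :> R by move: K3R; clear; lra.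
have n0 : 0 < 2 * K%:R :> R by move: n6; clear; lra.
pose vmin : R := (K%:R - 1) * (K%:R - 2) / 13.
have vmin13 : 2 / 13 <= vmin.
  have K30 : 0 <= K%:R - 3 :> R by rewrite subr_ge0.
  by have := mulr_ge0 K30 K30; rewrite /vmin;
    move: K3R; clear; move: (K%:R) => n; lra.
have vmin0 : 0 < vmin by move: vmin13; clear; lra.
have vminK : vmin < K%:R ^+ 2.
  by have := sqr_ge0 (K%:R : R); rewrite /vmin;
    move: K3R; clear; move: (K%:R) => n; lra.
have s2min0 : 0 < Num.sqrt vmin by rewrite sqrtr_gt0.
have s2minK : Num.sqrt vmin < K%:R.
  rewrite -[ltRHS](ger0_norm (ler0n _ K)) -sqrtr_sqr ltr_sqrt//.
  by rewrite (lt_trans vmin0).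
have vn : (2 * K%:R) ^+ 2 <= (73 / 10) ^+ 2 * ((K%:R ^+ 2 - 1) / 12 + 1 / 100) :> R.
  have K30 : 0 <= K%:R - 3 :> R by rewrite subr_ge0.
  by have := mulr_ge0 K30 K30; move: K3R; clear; move: (K%:R) => n; lra.
apply: (exists_nontrivial (la := 1 / 100 / (2 * K%:R)) (ha := 5 / 2 / (2 * K%:R))
  (lm2 := 1) (hm2 := K%:R + 2 / 10) (ls1 := 9 / 100) (hs1 := 21 / 200)
  (ls2 := Num.sqrt vmin) (hs2 := K%:R) hx) => //.
- by rewrite divr_gt0//; clear; lra.
- by rewrite ler_pM2r ?invr_gt0//; clear; lra.
- by rewrite ltr_pdivrMr//; move: n6; clear; lra.
- by clear; lra.
- by move: K3R; clear; lra.
- by clear; lra.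
- exact: ltW.
move=> a m1 m2 s1 s2 r [/andP[a1 a2] b1 b2 d1 /andP[e1 e2]] Fa F1 F2 T1 T2.
have [d11 d12] := andP d1; have [m1l m1h] := andP b1.
have s10 : 0 < s1 by move: d11; clear; lra.
have s20 : 0 < s2 by exact: lt_le_trans e1.
set A := 2 * K%:R * a.
have Al : 1 / 100 <= A by move: a1; rewrite ler_pdivrMr// [leRHS]mulrC.
have Ah : A <= 5 / 2 by move: a2; rewrite ler_pdivlMr// [leLHS]mulrC.
have A0 : 0 < A by move: Al; clear; lra.
have a0 : 0 < a by rewrite -(pmulr_rgt0 _ n0).
have a11 : a < 1.
  by rewrite -(ltr_pM2l n0) mulr1; apply: (le_lt_trans Ah); move: n6; clear; lra.
have s2v : vmin <= s2 ^+ 2.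
  rewrite -[leLHS]sqr_sqrtr ?(ltW vmin0)//.
  by rewrite lerXn2r ?nnegrE// ltW.
have v13 : 2 / 13 <= s2 ^+ 2 by exact: le_trans s2v.
set c := other_weight K a m2 s2.
have c0 y : 0 < c y.
  apply: mulr_gt0; last exact: gden_gt0.
  by rewrite mulr_gt0// subr_gt0.
have rE : r = cresp A m1 s1 c by apply/funext => y; exact: respE.
have r0 y : 0 < r y by rewrite rE; exact: cresp_gt0.
have r1 y : r y < 1 by rewrite rE; exact: cresp_lt1.
have q0 y : 0 < 1 - r y by rewrite subr_gt0.
have leak : off_sum K k (fun y => r y * (y - m1) ^+ 2) <= A / 2000.
  apply: off_sum_leak => // [|y yoff]; first exact: ltW.
  by rewrite rE; exact: many_pairs_leak yoff.
have sumA : pair_sum K (fun y => r y - a) = pair_sum K r - A.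
  by rewrite pair_sumD pair_sum_cst mulrN.
rewrite sumA in Fa.
have G2 : pair_sum K r <= 2 + A / 1280.
  have off1 : off_sum K k r <= 25 / 16 * (A / 2000).
    apply: (@le_trans _ _ (25 / 16 * off_sum K k (fun y => r y * (y - m1) ^+ 2))).
      rewrite -off_sumZ; apply: off_sum_le => y yoff.
      have d := off_point_sqr_dist yoff b1.
      rewrite mulrCA -[leLHS]mulr1 ler_pM2l//.
      by move: d; clear; lra.
    by rewrite ler_pM2l//; clear; lra.
  rewrite (pair_sumD1 _ hk); move: off1 (r1 k%:R) (r1 (k%:R + 2 / 10)).
  by move: (off_sum _ _ _) (r _) (r _) => o p q; clear; lra.
have ahi : a < 5 / 2 / (2 * K%:R).
  rewrite lt_neqAle a2 andbT; apply/eqP => e.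
  have Ae : A = 5 / 2 by rewrite /A e mulrC divfK// gt_eqF.
  have := Fa.1 ltac:(rewrite e ltr_pM2r ?invr_gt0//; clear; lra).
  by move: G2; rewrite Ae; move: (pair_sum _ _) => S; clear; lra.
have GA : pair_sum K r <= A by have := Fa.2 ahi; rewrite subr_le0.
have s2K : s2 < K%:R.
  by apply: (broad_sd_lt (ltnW K3) b2 e2 q0) => h; apply: T2.1; rewrite h.
have S2 := T2.2 s2K.
have vgt : vmin < s2 ^+ 2.
  by apply: (broad_sd_gt K3 hk b1 b2 Ah r0 r1 leak S2); rewrite sqr_ge0.
have s2gt : Num.sqrt vmin < s2.
  by rewrite -(ltr_pXn2r (_ : (0 < 2)%N)) ?nnegrE ?(ltW s20) ?(ltW s2min0)//
    sqr_sqrtr// ltW.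
have cb x0 : x0 = k%:R \/ x0 = k%:R + 2 / 10 -> c x0 <= 73 / 10 /\
    (s2 ^+ 2 / 2 <= (x0 - m2) ^+ 2 -> c x0 <= 597 / 100).
  move=> x0E; have bv := broad_variance hk b1 x0E (sqr_ge0 s2)
    (fun y => ltW (r0 y)) GA leak S2.
  have [B1 B2] := pair_weight_bound n6 A0 Ah vn bv v13 (sqr_ge0 (x0 - m2)).
  have nA : 2 * K%:R - A = 2 * K%:R * (1 - a) by rewrite /A mulrBr mulr1.
  rewrite nA in B1 B2; split=> [|/B2 {}B2]; apply: (other_weight_le a0 a11 s20).
  - by clear; lra.
  - exact: B1.
  - by clear; lra.
  apply: (le_trans B2); rewrite mulrA; apply: ler_wpM2r; last by clear; lra.
  by rewrite addr_ge0 ?sqr_ge0.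
have [cl1 cl2] := cb _ (or_introl erefl); have [cr1 cr2] := cb _ (or_intror erefl).
have P : on_pair K k A m1 s1 c.
  by split=> //; rewrite -?rE.
have alo : 1 / 100 / (2 * K%:R) < a.
  rewrite lt_neqAle a1 andbT; apply/eqP => e.
  have Ae : A = 1 / 100 by rewrite /A -e mulrC divfK// gt_eqF.
  have g := small_weight_gain Ae d11 d12 m1l m1h (c0 k%:R) cl1
    (c0 (k%:R + 2 / 10)) cr1.
  have off0 : 0 <= off_sum K k r by apply: off_sum_ge0 => y _; exact: ltW.
  move: GA; rewrite (pair_sumD1 _ hk); move: g off0; rewrite rE /cresp.
  by move: (off_sum _ _ _) (_ / _) (_ / _) => o p q; clear; lra.
have total : pair_sum K r = A by apply/eqP; rewrite -subr_eq0 (face_cond_interior Fa).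
have F2' := broad_mean_interior (ltnW K3) b2 q0 F2.
rewrite rE in F1 T1 total.
have [g1 g2] := comp_mean_interior P F1.
have mean := face_cond_interior F1 g1 g2.
have near2 : ((k%:R + 2 / 10) - k%:R) ^+ 2 <= (2 / 10) ^+ 2 :> R.
  by rewrite (_ : k%:R + 2 / 10 - k%:R = 2 / 10) ?lexx//; ring.
split.
  rewrite alo ahi g1 g2 F2' s2gt s2K; split=> //.
  rewrite (comp_sd_lt P total mean T1.1) andbT.
  apply: (comp_sd_gt P total mean _ _ T1.2).
    have [h|/ltW h] := leP (s2 ^+ 2 / 2) ((k%:R - m2) ^+ 2).
      by left; exact: cl2.
    by right; apply: other_weight_ratio.
  have [h|/ltW h] := leP (s2 ^+ 2 / 2) ((k%:R + 2 / 10 - m2) ^+ 2).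
    by left; exact: cr2.
  by right; apply: other_weight_ratio => //; rewrite -sqrrN opprB.
case=> _ es; move: v13; rewrite -es.
have := sqr_le_dist (_ : - (21 / 200) <= s1) d12.
move=> /(_ ltac:(move: s10; clear; lra)).
by clear; lra.
Qed.

End ManyPairsCritical.

Unset Implicit Arguments.

Theorem theorem3 (R : realType) (K : nat) (hK : (2 <= K)%N) (x : nat -> R)
    (hx : forall j : nat, (1 <= j <= K)%N ->
      x (2 * j - 1)%N = j%:R /\ x (2 * j)%N = j%:R + 2 / 10) :
  (forall k : nat, (1 <= k <= K)%N ->
     exists a m1 m2 s1 s2 : R,
       nontrivial_critical_point (loglik (2 * K) x) (a, m1, m2, s1, s2) /\
       k%:R < m1 < k%:R + 2 / 10)
  /\ `I_K #<= [set p : param R | nontrivial_critical_point (loglik (2 * K) x) p].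
Proof.
have crit k : (1 <= k <= K)%N -> exists a m1 m2 s1 s2 : R,
    nontrivial_critical_point (loglik (2 * K) x) (a, m1, m2, s1, s2) /\
    k%:R < m1 < k%:R + 2 / 10.
  move: hK; rewrite leq_eqVlt => /predU1P[K2|K3]; last first.
    by move=> hk; exact: many_pairs_critical.
  rewrite -K2 in hx * => hk; apply: (@two_pairs_critical _ x k (3 - k)) => //.
  by rewrite subnKC//; case/andP: hk => _ /leq_trans; apply.
split=> //.
have pt (k : nat) : exists p : param R, (k < K)%N ->
    nontrivial_critical_point (loglik (2 * K) x) p /\
    k.+1%:R < p.1.1.1.2 < k.+1%:R + 2 / 10.
  have [kK|kK] := boolP (k < K)%N; last by exists (0, 0, 0, 0, 0).
  have [a [m1 [m2 [s1 [s2 [cp m1k]]]]]] := crit k.+1 kK.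
  by exists (a, m1, m2, s1, s2).
have [f fP] := choice pt.
have finj : set_inj `I_K f.
  move=> i j; rewrite !inE/= => iK jK fij.
  have [_ /andP[i1 i2]] := fP i iK; have [_ /andP[j1 j2]] := fP j jK.
  rewrite fij in i1 i2.
  have lt (u v : nat) (z : R) : u.+1%:R < z -> z < v.+1%:R + 2 / 10 -> (u <= v)%N.
    move=> h1 h2; rewrite leqNgt; apply/negP => vu.
    have : v.+2%:R <= u.+1%:R :> R by rewrite ler_nat.
    by rewrite -[v.+2%:R]natr1; move: h1 h2; clear; lra.
  by apply/eqP; rewrite eqn_leq (lt _ _ _ i1 j2) (lt _ _ _ j1 i2).
have fun_f : set_fun `I_K
    [set p | nontrivial_critical_point (loglik (2 * K) x) p] f.
  by move=> k /= kK; have [] := fP k kK.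
rewrite -(card_le_eql (inj_card_eq finj)).
apply: subset_card_le => _ [k kK <-]; exact: fun_f.
Qed.
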